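(* Let $\Phi:[0,\infty]\to[0,\infty]$ be a non-decreasing function and set $H(t)=\log\Phi(t)$. Then the equality $$(a)\quad \int_\Delta^\infty H'(t)\,\frac{dt}{t}=\infty$$ implies the equality $$(b)\quad \int_\Delta^\infty\frac{dH(t)}{t}=\infty,$$ and (b) is equivalent to $$(c)\quad \int_\Delta^\infty H(t)\,\frac{dt}{t^2}=\infty$$ for some $\Delta>0$; and (c) is equivalent to each of the equalities: $$(d)\quad \int_0^\delta H\!\left(\tfrac1t\right)dt=\infty \text{ for some } \delta>0,$$ $$(e)\quad \int_{\Delta_*}^\infty\frac{d\eta}{H^{-1}(\eta)}=\infty \text{ for some } \Delta_*>H(+0),$$ $$(f)\quad \int_{\delta_*}^\infty\frac{d\tau}{\tau\,\Phi^{-1}(\tau)}=\infty \text{ for some } \delta_*>\Phi(+0).$$ Moreover, (a) is equivalent to (b), and hence (a)–(f) are all equivalent to each other, if $\Phi$ is in addition absolutely continuous. In particular, all of (a)–(f) are equivalent if $\Phi$ is convex and non-decreasing.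
   Context: For a non-decreasing $F$, the inverse is $F^{-1}(\tau)=\inf\{t\in[0,\infty]: F(t)\ge\tau\}$ (with $\inf\emptyset=\infty$); this applies to $\Phi$ and to $H$ (with values in $[-\infty,\infty]$). The integral in (b) is a Lebesgue–Stieltjes integral; the others are Lebesgue integrals. In (a) and (b) the integrals are defined to be $\infty$ if $\Phi(t)=\infty$ (resp. $H(t)=\infty$) for all $t\ge T$ for some $T$. If $\Phi=0$ on $[0,t_*]$ then $H=-\infty$ there and one sets $H'=0$ there; with $t_0=\sup\{t:\Phi(t)=0\}$ ($t_0=0$ if $\Phi(0)>0$) one takes $\Delta>t_0$ and $\delta<1/t_0$ in (a)–(d). The right-hand sides $\infty$ mean $+\infty$.
   Formalization: The equivalences of (c) with (e) and with (f) are stated under the added assumption Φ(+0) < ∞; if Φ = ∞ on (0,∞], (c) and (d) hold but no Δ_* > H(+0) or δ_* > Φ(+0) exists, so the literal claim fails there. *)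

(* Defs.v *)
From HB Require Import structures.
From mathcomp Require Import all_boot all_order all_algebra.
From mathcomp Require Import all_classical all_reals all_analysis.
Set Implicit Arguments. Unset Strict Implicit. Unset Printing Implicit Defensive.
Import Order.TTheory GRing.Theory Num.Theory.
Import numFieldNormedType.Exports.
Local Open Scope classical_set_scope.
Local Open Scope ring_scope.

Section LS.
Context {R : realType}.
Variables (Phi : R -> \bar R) (D : R).

Definition LSok : Prop :=
  [/\ (forall s t, 0 <= s -> s <= t -> (Phi s <= Phi t)%E),
      0 < D, (0 < Phi D)%E & (forall t, D <= t -> (Phi t < +oo)%E)].

Hypothesis hok : LSok.

Definition LS_hr (t : R) : R := ln (fine (Phi (Num.max t D))).

Lemma LS_hr_nd : {homo LS_hr : s t / s <= t}.
Proof.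
case: hok => mono D0 PD0 fin s t st; rewrite /LS_hr.
have Ds : D <= Num.max s D by rewrite le_max lexx orbT.
have Dt : D <= Num.max t D by rewrite le_max lexx orbT.
have pos x : D <= x -> (0 < Phi x)%E.
  by move=> Dx; apply: (lt_le_trans PD0); apply: mono => //; exact: ltW.
have fn x : D <= x -> Phi x \is a fin_num.
  move=> Dx; rewrite ge0_fin_numE ?fin//; exact/ltW/pos.
have fpos x : D <= x -> 0 < fine (Phi x).
  by move=> Dx; rewrite fine_gt0// pos// fin.
rewrite ler_ln ?posrE ?fpos//; apply: fine_le; rewrite ?fn//.
apply: mono; first by apply: le_trans Ds; exact: ltW.
exact: le_max2.
Qed.

Definition LS_G (t : R) : R := inf [set LS_hr s | s in `]t, +oo[].

Let lbS t : has_lbound [set LS_hr s | s in `]t, +oo[].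
Proof.
exists (LS_hr t) => _ [s /= + <-]; rewrite in_itv /= andbT => ts.
exact/LS_hr_nd/ltW.
Qed.

Let neS t : nonempty [set LS_hr s | s in `]t, +oo[].
Proof. by exists (LS_hr (t + 1)), (t + 1) => //=; rewrite in_itv/= ltrDl ltr01. Qed.

Lemma LS_G_nd : {homo LS_G : s t / s <= t}.
Proof.
move=> s t st; rewrite /LS_G; apply: lb_le_inf => //.
move=> _ [u /= + <-]; rewrite in_itv/= andbT => tu.
apply: ge_inf => //; exists u => //=; rewrite in_itv/= andbT.
exact: le_lt_trans tu.
Qed.

Lemma LS_G_rc (x : R) : LS_G @ at_right x --> LS_G x.
Proof.
apply/cvgrPdist_lt => e e0.
have [y /= [s /=]] := inf_adherent e0 (conj (neS x) (lbS x)).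
rewrite in_itv/= andbT => xs <- hs.
near=> z.
have xz : x < z by near: z; exact: nbhs_right_gt.
have zs : z < s by near: z; exact: nbhs_right_lt.
have h1 : LS_G x <= LS_G z by apply: LS_G_nd; exact: ltW.
have h2 : LS_G z <= LS_hr s.
  by apply: ge_inf => //; exists s => //=; rewrite in_itv/= zs.
rewrite distrC ger0_norm ?subr_ge0// ltrBlDl.
by apply: (le_lt_trans h2); exact: hs.
Unshelve. all: by end_near.
Qed.

End LS.

Definition LS_cum {R : realType} (Phi : R -> \bar R) (D : R) (h : LSok Phi D) :
  R -> R := LS_G Phi D.

HB.instance Definition _ {R : realType} (Phi : R -> \bar R) (D : R)
  (h : LSok Phi D) :=
  isCumulative.Build R _ R (LS_cum h) (LS_G_nd h) (LS_G_rc h).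

Local Open Scope ereal_scope.

(* Lebesgue--Stieltjes integral  \int_[D, +oo[ dH(t) / t  of H = log Phi,
   computed w.r.t. the Lebesgue--Stieltjes measure of the right-continuous
   regularization of t |-> H(max t D)  (only meaningful when LSok Phi D). *)
Definition LS_integral {R : realType} (Phi : R -> \bar R) (D : R) : \bar R :=
  match pselect (LSok Phi D) with
  | left h => \int[lebesgue_stieltjes_measure (LS_cum h)]_(t in `[D, +oo[%classic)
                 (t^-1)%:E
  | right _ => 0
  end.

Section Conditions.
Context {R : realType}.
Implicit Types (Phi : R -> \bar R).

Definition nondecreasing0 Phi := forall s t : R, (0 <= s)%R -> (s <= t)%R -> Phi s <= Phi t.
Definition nonneg0 Phi := forall t : R, (0 <= t)%R -> 0 <= Phi t.

Definition H Phi (t : R) : \bar R := lne (Phi t).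

Definition t0 Phi : \bar R :=
  ereal_sup ([set t%:E | t in [set t : R | (0 <= t)%R /\ Phi t = 0]] `|` [set 0]).

(* H(+0) and Phi(+0): right limits at 0, i.e. infima over ]0,+oo[ (monotone) *)
Definition Hp0 Phi : \bar R := ereal_inf [set H Phi t | t in `]0%R, +oo[%classic].
Definition Phip0 Phi : \bar R := ereal_inf [set Phi t | t in `]0%R, +oo[%classic].

(* generalized inverses F^{-1}(tau) = inf {t in [0,oo] : F t >= tau}, inf set0 = +oo *)
Definition Phiinv Phi (tau : R) : \bar R :=
  ereal_inf [set t%:E | t in [set t : R | (0 <= t)%R /\ tau%:E <= Phi t]].
Definition Hinv Phi (eta : R) : \bar R :=
  ereal_inf [set t%:E | t in [set t : R | (0 <= t)%R /\ eta%:E <= H Phi t]].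

Definition erecip (x : \bar R) : \bar R :=
  match x with r%:E => (r^-1)%:E | _ => 0 end.

Definition Hreal Phi (t : R) : R := ln (fine (Phi t)).
Definition Hder Phi (t : R) : R :=
  if `[< derivable (Hreal Phi) t 1%R >] then derive1 (Hreal Phi) t else 0%R.

Definition eventually_infty Phi := exists T : R, forall t, (T <= t)%R -> Phi t = +oo.

Definition cond_a Phi := exists D : R, t0 Phi < D%:E /\
  (eventually_infty Phi \/
   \int[lebesgue_measure]_(t in `[D, +oo[%classic) (Hder Phi t / t)%:E = +oo).

Definition cond_b Phi := exists D : R, t0 Phi < D%:E /\
  (eventually_infty Phi \/ LS_integral Phi D = +oo).

Definition cond_c Phi := exists D : R, t0 Phi < D%:E /\
  \int[lebesgue_measure]_(t in `[D, +oo[%classic) (H Phi t * (t ^- 2)%:E) = +oo.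

Definition cond_d Phi := exists d : R, (0 < d)%R /\ d%:E * t0 Phi < 1 /\
  \int[lebesgue_measure]_(t in `]0%R, d]%classic) H Phi (t^-1) = +oo.

Definition cond_e Phi := exists Ds : R, Hp0 Phi < Ds%:E /\
  \int[lebesgue_measure]_(eta in `[Ds, +oo[%classic) erecip (Hinv Phi eta) = +oo.

Definition cond_f Phi := exists ds : R, Phip0 Phi < ds%:E /\
  \int[lebesgue_measure]_(tau in `[ds, +oo[%classic)
     erecip (tau%:E * Phiinv Phi tau) = +oo.

Definition abs_cont_on (a b : R) (f : R -> R) : Prop :=
  forall eps : R, (0 < eps)%R -> exists2 delta : R, (0 < delta)%R &
    forall (n : nat) (u v : nat -> R),
      (forall k, (k < n)%N -> (a <= u k)%R /\ (u k <= v k)%R /\ (v k <= b)%R) ->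
      (forall i j, (i < j)%N -> (j < n)%N -> (v i <= u j)%R \/ (v j <= u i)%R) ->
      (\sum_(k < n) (v k - u k) < delta)%R ->
      (\sum_(k < n) `|f (v k) - f (u k)| < eps)%R.

Definition abs_cont0 Phi : Prop :=
  (forall t : R, (0 <= t)%R -> Phi t < +oo) /\
  forall M : R, (0 < M)%R -> abs_cont_on 0 M (fun t => fine (Phi t)).

Definition convex0 Phi : Prop :=
  forall (x y l : R), (0 <= x)%R -> (0 <= y)%R -> (0 < l < 1)%R ->
    Phi (l * x + (1 - l) * y)%R <= l%:E * Phi x + (1 - l)%:E * Phi y.

End Conditions.

(* Main.v *)
Require Import Defs.
From HB Require Import structures.
From mathcomp Require Import all_boot all_order all_algebra.
From mathcomp Require Import all_classical all_reals all_analysis.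
From mathcomp Require Import measurable_realfun.
From mathcomp Require Import ring lra.
Import Order.TTheory GRing.Theory Num.Theory.
Import numFieldNormedType.Exports.
Local Open Scope classical_set_scope.
Local Open Scope ring_scope.
Local Open Scope ereal_scope.

(** Every condition is equivalent to the divergence of the integral of
    [max(H, 0) / s^2] at infinity ([logtail] below). Writing [1/x] as the integral
    of [s^-2] from [x] to infinity, Tonelli turns
    [\int w(x) / phi(x) dnu(x)] into [\int (\int_(phi <= s) w dnu) ds / s^2]; with
    nu the Stieltjes measure dH and phi = id, or nu the Lebesgue measure and
    phi = H^-1, the inner integral is H(s) up to a constant, which gives (b) and (e); (f) is (e)
    with weight w(tau) = 1/tau.
    For (d), layer-cake decomposition replaces the substitution t = 1/s.
    For (a) => (b), H' is the limit of difference quotients, whose integrals against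
    dt/t are at most a constant times [\int dH(x) / x] by Tonelli; conclude by Fatou.
    Conversely, absolute continuity passes from Phi to H = log Phi away from the
    zeros of Phi, so that dH << dt, and by Lebesgue differentiation the
    Radon-Nikodym density of dH is H' almost everywhere.
    A finite convex nondecreasing function is locally Lipschitz. *)

(** * Monotonicity of lower integrals, measurability, and Tonelli over a relation *)

Local Notation leb := lebesgue_measure.

(* No measurability is assumed: the integral of a nonnegative function is a supremum
   over the simple functions below it. This matters for [Hder]. *)
Lemma le_subset_lower_integral d (T : measurableType d) (R : realType)
    (m : {measure set T -> \bar R}) (A B : set T) (f g : T -> \bar R) :
  A `<=` B -> (forall x, A x -> 0 <= f x) -> (forall x, A x -> f x <= g x) ->
  (forall x, B x -> 0 <= g x) ->
  \int[m]_(x in A) f x <= \int[m]_(x in B) g x.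
Proof.
move=> AB f0 fg g0; rewrite (integral_mkcond A) (integral_mkcond B).
rewrite !ge0_integralTE; [|exact: erestrict_ge0|exact: erestrict_ge0].
apply: le_ereal_sup => _ [h hf <-]; exists h => // x.
apply: (le_trans (hf x)); rewrite patchE; case: ifPn => [/set_mem Ax|_].
  by rewrite patchE mem_set ?fg//; exact: AB.
exact: erestrict_ge0.
Qed.

Lemma le_lower_integral d (T : measurableType d) (R : realType)
    (m : {measure set T -> \bar R}) (D : set T) (f g : T -> \bar R) :
  (forall x, D x -> 0 <= f x) -> (forall x, D x -> f x <= g x) ->
  \int[m]_(x in D) f x <= \int[m]_(x in D) g x.
Proof.
move=> f0 fg; apply: le_subset_lower_integral => // x Dx.
exact: le_trans (f0 _ Dx) (fg _ Dx).
Qed.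

(** The preimage in [D] of a ray [[r, +oo]] is an interval by monotonicity, and these rays generate
    the Borel sets of the extended line. *)
Lemma emeasurable_fun_nd (R : realType) (D : set R) (f : R -> \bar R) :
  is_interval D -> (forall s t, D s -> D t -> (s <= t)%R -> f s <= f t) ->
  measurable_fun D f.
Proof.
move=> iD ndf; have mD : measurable D by exact: is_interval_measurable.
apply: (measurability (@ErealGenCInfty.G R)) => [|/= _ [_] [r ->] <-].
  exact: ErealGenCInfty.measurableE.
apply: is_interval_measurable => s t/= [Ds].
rewrite !in_itv/= !andbT => fs [Dt ft] u /andP[su ut].
have Du : D u by apply: iD Ds Dt _ _; rewrite su.
by split => //; rewrite in_itv/= andbT (le_trans fs)// ndf.
Qed.

(** Inversion is continuous on each open half-line; the point 0, where [0^-1 = 0] by convention, is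
    a measurable piece of its own. *)
Lemma measurable_invr (R : realType) (D : set R) :
  measurable D -> measurable_fun D (fun x : R => x^-1)%R.
Proof.
move=> mD; apply: (measurable_funS measurableT) => //.
have -> : (@setT R) = `]-oo, 0%R[ `|` ([set 0%R] `|` `]0%R, +oo[).
  rewrite eqEsubset; split => // x _; rewrite /setU/= !in_itv/= andbT.
  by case: (ltgtP x 0%R) => [|//|->]; auto.
have c0 (x : R) : x != 0%R -> {for x, continuous (fun x : R => x^-1)%R}.
  exact: inv_continuous.
apply/measurable_funU => //; first exact: measurableU.
split; last apply/measurable_funU => //; last split.
- apply: open_continuous_measurable_fun => // x; rewrite inE/= in_itv/= => x0.
  by apply: c0; rewrite lt_eqF.
- exact: measurable_fun_set1.
- apply: open_continuous_measurable_fun => // x; rewrite inE/= in_itv/= andbT.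
  by move=> x0; apply: c0; rewrite gt_eqF.
Qed.

Lemma measurable_invsq (R : realType) (D : set R) :
  measurable D -> measurable_fun D (fun x : R => (x ^- 2)%:E).
Proof.
move=> mD; apply/measurable_EFinP.
apply: (@measurableT_comp _ _ _ _ _ _ (fun x : R => x^-1)%R).
  exact: measurable_invr.
exact: measurable_funX.
Qed.

Lemma integral_invsq_c (R : realType) (a : R) : (0 < a)%R ->
  \int[leb]_(s in `[a, +oo[) (s ^- 2)%:E = (a^-1)%:E.
Proof.
move=> a0; pose F (x : R) := (- x^-1)%R.
have dF (x : R) : (x != 0)%R -> is_derive x 1%R F (x ^- 2)%R.
  move=> x0.
  have := @is_deriveN _ _ _ _ _ _ _ (is_deriveV x0 (is_derive_id x 1%R)).
  by rewrite /F scaler1 opprK.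
rewrite (@ge0_continuous_FTC2y _ _ F a 0%R).
- by rewrite sub0e /F EFinN oppeK.
- by move=> x ax; rewrite invr_ge0 sqr_ge0.
- apply: continuous_in_subspaceT => x; rewrite inE/= in_itv/= andbT => ax.
  have x0 : x != 0%R by rewrite gt_eqF// (lt_le_trans a0).
  apply: (@continuous_comp _ _ _ (fun x : R => x ^+ 2)%R (fun x : R => x^-1)%R).
    exact: exprn_continuous.
  by apply: inv_continuous; rewrite expf_neq0.
- rewrite -oppr0; apply: cvgN; apply/gtr0_cvgV0.
    by near=> x; near: x; exact: nbhs_pinfty_gt.
  exact: cvg_id.
- move=> x ax; have x0 : x != 0%R by rewrite gt_eqF// (lt_trans a0).
  by have [] := dF _ x0.
- apply: cvg_at_right_filter; apply: cvgN; apply: inv_continuous.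
  by rewrite gt_eqF.
- move=> x; rewrite in_itv/= andbT => ax.
  have x0 : x != 0%R by rewrite gt_eqF// (lt_trans a0).
  by rewrite derive1E; have /@derive_val := dF _ x0.
Unshelve. all: by end_near. Qed.

Lemma measurable_erecip d (T : measurableType d) (R : realType) (A : set T)
    (f : T -> \bar R) :
  measurable_fun A f -> measurable_fun A (fun x => erecip (f x)).
Proof.
move=> mf.
have -> : (fun x => erecip (f x)) = fun x => ((fine (f x))^-1)%:E.
  by apply/funext => x; case: (f x) => //=; rewrite invr0.
apply/measurable_EFinP.
apply: (@measurableT_comp _ _ _ _ _ _ (fun x : R => x^-1)%R).
  exact: measurable_invr.
exact: (measurableT_comp (fine_measurable measurableT)).
Qed.

(** Both sides are iterated integrals of [w x * q y] over the part of [E] inside the product of [A]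
    and [B]. Extension by zero brings this to Tonelli on the whole product space. *)
Lemma tonelli_relation d1 d2 (T1 : measurableType d1) (T2 : measurableType d2)
    (R : realType) (m1 : {sigma_finite_measure set T1 -> \bar R})
    (m2 : {sigma_finite_measure set T2 -> \bar R}) (A : set T1) (B : set T2)
    (w : T1 -> \bar R) (q : T2 -> \bar R) (E : set (T1 * T2)) :
  measurable A -> measurable B -> measurable E ->
  measurable_fun A w -> measurable_fun B q ->
  (forall x, A x -> 0 <= w x) -> (forall y, B y -> 0 <= q y) ->
  \int[m1]_(x in A) (w x * \int[m2]_(y in B `&` [set y | E (x, y)]) q y) =
  \int[m2]_(y in B) (q y * \int[m1]_(x in A `&` [set x | E (x, y)]) w x).
Proof.
move=> mA mB mE mw mq w0 q0.
pose g z := (w \_ A) z.1 * (q \_ B) z.2.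
have qB0 y : 0 <= (q \_ B) y by exact: erestrict_ge0.
have wA0 x : 0 <= (w \_ A) x by exact: erestrict_ge0.
have mwA : measurable_fun setT (w \_ A) by exact: (measurable_restrictT _ mA).1.
have mqB : measurable_fun setT (q \_ B) by exact: (measurable_restrictT _ mB).1.
have mg : measurable_fun setT g.
  apply: emeasurable_funM; first exact: (measurableT_comp mwA).
  exact: (measurableT_comp mqB).
have mF : measurable_fun setT (g \_ E).
  by apply: (measurable_restrictT _ mE).1 => //; exact: measurable_funTS.
have F0 z : 0 <= (g \_ E) z by apply: erestrict_ge0 => ? _; exact: mule_ge0.
have FE x y : (g \_ E) (x, y) = (w \_ A) x * ((q \_ B) \_ [set y | E (x, y)]) y.
  rewrite [LHS]patchE [X in _ * X]patchE.
  have -> : ((x, y) \in E) = (y \in [set y | E (x, y)]).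
    by apply/idP/idP => /set_mem h; exact/mem_set.
  by case: ifP => //; rewrite mule0.
have FE' x y : (g \_ E) (x, y) = (q \_ B) y * ((w \_ A) \_ [set x | E (x, y)]) x.
  rewrite [LHS]patchE [X in _ * X]patchE.
  have -> : ((x, y) \in E) = (x \in [set x | E (x, y)]).
    by apply/idP/idP => /set_mem h; exact/mem_set.
  by case: ifP => //; rewrite ?mule0// muleC.
transitivity (\int[m1]_x \int[m2]_y (g \_ E) (x, y)).
  rewrite integral_mkcond; apply: eq_integral => x _.
  under eq_integral do rewrite FE.
  have mS : measurable [set y | E (x, y)].
    have := @measurable_xsection _ _ _ _ _ x mE; rewrite xsectionE; exact.
  rewrite ge0_integralZl//; last 2 first.
    by apply: (measurable_restrictT _ mS).1; exact: measurable_funTS.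
    by move=> y _; apply: erestrict_ge0.
  rewrite [(w \_ A) x]patchE [LHS]patchE; case: ifPn => Ax; last by rewrite mul0e.
  by congr *%E; rewrite -integral_mkcond -integral_mkcondl.
rewrite (fubini_tonelli (g \_ E) mF F0) [RHS]integral_mkcond.
apply: eq_integral => y _.
under eq_integral do rewrite FE'.
have mS : measurable [set x | E (x, y)].
  have := @measurable_ysection _ _ _ _ _ y mE; rewrite ysectionE; exact.
rewrite ge0_integralZl//; last 2 first.
  by apply: (measurable_restrictT _ mS).1; exact: measurable_funTS.
  by move=> x _; apply: erestrict_ge0.
rewrite [(q \_ B) y]patchE [RHS]patchE; case: ifPn => By; last by rewrite mul0e.
by congr *%E; rewrite -integral_mkcond -integral_mkcondl.
Qed.

(** * Integrals of [w / phi] as tail integrals against [ds / s^2] *)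

Section tail.
Context d (T : measurableType d) (R : realType).
Variables (nu : {sigma_finite_measure set T -> \bar R}) (A : set T).
Variables (w phi : T -> \bar R).
Hypotheses (mA : measurable A) (mw : measurable_fun A w).
Hypotheses (mphi : measurable_fun A phi).
Hypotheses (w0 : forall x, A x -> 0 <= w x) (phi0 : forall x, A x -> 0 < phi x).

(* Tonelli for the kernel [1_{phi x <= s} / s^2], since [1/r] is the integral of [s^-2] from [r] to infinity. *)
Lemma integral_erecip_tail :
  \int[nu]_(x in A) (w x * erecip (phi x)) =
  \int[leb]_(s in `]0%R, +oo[)
    ((\int[nu]_(x in A `&` [set x | phi x <= s%:E]) w x) * (s ^- 2)%:E).
Proof.
pose phi' := phi \_ A.
pose E : set (T * measurableTypeR R) := [set z | phi' z.1 <= z.2%:E].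
have mphi' : measurable_fun setT phi' by exact: (measurable_restrictT _ mA).1.
have mE : measurable E.
  rewrite -[E]setTI; apply: measurable_lee => //.
    exact: (measurableT_comp mphi').
  by apply/measurable_EFinP.
have mq : measurable_fun (`]0%R, +oo[ : set (measurableTypeR R)) (fun s : R => (s ^- 2)%:E).
  exact: measurable_invsq.
have q0 (s : R) : `]0%R, +oo[%classic s -> 0 <= (s ^- 2)%:E.
  by rewrite lee_fin invr_ge0 sqr_ge0.
have AE (s : R) : A `&` [set x | E (x, s)] = A `&` [set x | phi x <= s%:E].
  by apply/seteqP; split => [x/= [Ax]|x/= [Ax]]; rewrite /E /phi' /= patchE mem_set.
under [RHS]eq_integral do rewrite muleC -AE.
rewrite -(@tonelli_relation _ _ T (measurableTypeR R) R nu leb)//.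
apply: eq_integral => x /set_mem Ax; congr *%E.
have -> : [set s | E (x, s)] = [set s : R | phi x <= s%:E].
  by apply/seteqP; split => s; rewrite /E /phi' /= patchE mem_set.
have := phi0 _ Ax; case: (phi x) => [r| |]//; rewrite ?lte_fin => r0.
  rewrite (_ : _ `&` _ = `[r, +oo[%classic) ?integral_invsq_c//.
  apply/seteqP; split => [s/= []|s/=]; rewrite !in_itv/= !andbT lee_fin//.
  by move=> rs; split => //; exact: lt_le_trans rs.
rewrite (_ : _ `&` _ = set0) ?integral_set0//.
by apply/seteqP; split => [s/= []|s//]; rewrite leye_eq.
Qed.

Lemma le_tail_integral_erecip (k : R -> \bar R) :
  (forall s, (0 < s)%R -> 0 <= k s) ->
  (forall s, (0 < s)%R -> k s <= \int[nu]_(x in A `&` [set x | phi x <= s%:E]) w x) ->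
  \int[leb]_(s in `]0%R, +oo[) (k s * (s ^- 2)%:E) <=
  \int[nu]_(x in A) (w x * erecip (phi x)).
Proof.
move=> k0 kw; rewrite integral_erecip_tail.
have s20 (s : R) : 0 <= (s ^- 2)%:E by rewrite lee_fin invr_ge0 sqr_ge0.
apply: le_lower_integral => s /=; rewrite in_itv/= andbT => s0.
  by rewrite mule_ge0// k0.
by rewrite lee_wpmul2r// kw.
Qed.

End tail.

(* Cutting at [s / 2] rather than [s] makes the hypothesis insensitive to the jumps of
   [k], at the price of the factor 2. *)
Lemma integral_erecip_le_tail d (T : measurableType d) (R : realType)
    (nu : {sigma_finite_measure set T -> \bar R}) (A : set T)
    (w phi : T -> \bar R) (k : R -> \bar R) :
  measurable A -> measurable_fun A w -> measurable_fun A phi ->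
  (forall x, A x -> 0 <= w x) -> (forall x, A x -> 0 < phi x) ->
  (forall s, (0 < s)%R ->
    \int[nu]_(x in A `&` [set x | phi x <= (s / 2)%:E]) w x <= k s) ->
  \int[nu]_(x in A) (w x * erecip (phi x)) <=
  2%:E * \int[leb]_(s in `]0%R, +oo[) (k s * (s ^- 2)%:E).
Proof.
move=> mA mw mphi w0 phi0 wk.
(* The exact tail formula is applied to [2 phi], because [2 phi <= s] means [phi <= s / 2]. At the
   infinite values both sides are 0. *)
have er (x : \bar R) : erecip x = 2%:E * erecip (2%:E * x).
  case: x => [r| |] /=.
  - by rewrite -EFinM invfM mulrA divff ?mul1r.
  - by rewrite gt0_muley ?mule0// lte_fin.
  - by rewrite gt0_muleNy ?mule0// lte_fin.
have er0 x : A x -> 0 <= erecip (2%:E * phi x).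
  by move=> /phi0; case: (phi x) => [r| |]//= r0;
    rewrite ?gt0_muley ?lte_fin// lee_fin invr_ge0 mulr_ge0// ltW.
have m2 : measurable_fun A (fun x => 2%:E * phi x) by exact: measurable_funeM.
have s20 (s : R) : 0 <= (s ^- 2)%:E by rewrite lee_fin invr_ge0 sqr_ge0.
under eq_integral do rewrite er muleCA.
rewrite ge0_integralZl//; last 2 first.
- apply: emeasurable_funM => //.
  exact: measurable_erecip.
- by move=> x Ax; rewrite mule_ge0 ?w0 ?er0.
rewrite lee_pmul2l ?lte_fin// integral_erecip_tail//; last first.
  by move=> x Ax; rewrite mule_gt0 ?lte_fin// phi0.
apply: le_lower_integral => s /=; rewrite in_itv/= andbT => s0.
  rewrite mule_ge0//; apply: integral_ge0 => x [Ax _]; exact: w0.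
rewrite lee_wpmul2r// (le_trans _ (wk _ s0))// le_eqVlt; apply/orP; left.
apply/eqP; congr (integral _ _ _); apply/seteqP.
have h (y : \bar R) : (2%:E * y <= s%:E) = (y <= (s / 2)%:E).
  case: y => [r| |].
  - by rewrite -EFinM !lee_fin ler_pdivlMr// mulrC.
  - by rewrite gt0_muley ?lte_fin.
  - by rewrite gt0_muleNy ?lte_fin// !leNye.
by split => x /= []; rewrite h.
Qed.

Lemma ltey_adde_eqy (R : realDomainType) (x y : \bar R) :
  x < +oo -> x + y = +oo -> y = +oo.
Proof. by case: x y => [x| |] [y| |]. Qed.

(** * The tail integral of the positive part of H *)

Section logtail.
Context {R : realType}.
Variable Phi : R -> \bar R.

Definition logtail (D : R) : \bar R :=
  \int[leb]_(s in `[D, +oo[) (maxe (H Phi s) 0 * (s ^- 2)%:E).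

(** The form in which Tonelli produces the tail: over the whole half-line, above a base level [c].
    When [c] bounds H at some positive point, the integrand vanishes near 0, so that the singularity
    of [s^-2] is harmless. *)
Definition excess (c : R) : \bar R :=
  \int[leb]_(s in `]0%R, +oo[) (maxe (H Phi s - c%:E) 0 * (s ^- 2)%:E).

Hypotheses (nn : nonneg0 Phi) (nd : nondecreasing0 Phi).

Lemma invsq_ge0 (s : R) : 0 <= (s ^- 2)%:E.
Proof. by rewrite lee_fin invr_ge0 sqr_ge0. Qed.

Lemma maxe0_ge0 (x : \bar R) : 0 <= maxe x 0.
Proof. by rewrite le_max lexx orbT. Qed.
Hint Resolve invsq_ge0 maxe0_ge0 : core.

Lemma H_nd (s t : R) : (0 <= s)%R -> (s <= t)%R -> H Phi s <= H Phi t.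
Proof.
move=> s0 st; have t0 := le_trans s0 st.
by rewrite lee_lne ?nd// in_itv/= ?nn//= leey.
Qed.

Lemma measurable_H (D : set R) : is_interval D -> (forall x, D x -> (0 <= x)%R) ->
  measurable_fun D (H Phi).
Proof. by move=> iD D0; apply: emeasurable_fun_nd => // s t Ds _; apply/H_nd/D0. Qed.

Lemma is_interval_itv (i : interval R) : is_interval [set` i].
Proof. exact: interval_is_interval. Qed.
Hint Resolve is_interval_itv : core.

Lemma measurable_H_itv (D : R) : (0 <= D)%R -> measurable_fun `[D, +oo[ (H Phi).
Proof.
move=> D0; apply: measurable_H => // x /=; rewrite in_itv/= andbT.
exact: le_trans.
Qed.

Lemma measurable_H_pos : measurable_fun (`]0%R, +oo[ : set R) (H Phi).
Proof. by apply: measurable_H => // x /=; rewrite in_itv/= andbT => /ltW. Qed.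

Lemma measurable_excess (E : set R) (c : R) : measurable E ->
  measurable_fun E (H Phi) ->
  measurable_fun E (fun s => maxe (H Phi s - c%:E) 0 * (s ^- 2)%:E).
Proof.
move=> mE mH; apply: emeasurable_funM; last exact: measurable_invsq.
by apply: measurable_maxe => //; apply: emeasurable_funB.
Qed.

Lemma measurable_logtail (E : set R) : measurable E ->
  measurable_fun E (H Phi) ->
  measurable_fun E (fun s => maxe (H Phi s) 0 * (s ^- 2)%:E).
Proof.
move=> mE mH; apply: emeasurable_funM; last exact: measurable_invsq.
by apply: measurable_maxe.
Qed.

(** Beyond the larger of [T] and [D] the integrand is constantly infinite. *)
Lemma logtail_y (T D : R) : (0 <= T)%R -> H Phi T = +oo -> (0 < D)%R ->
  logtail D = +oo.
Proof.
move=> T0 HT D0; apply/eqP; rewrite -leye_eq.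
pose M := Num.max T D.
have DM : (D <= M)%R by rewrite le_max lexx orbT.
apply: (@le_trans _ _ (\int[leb]_(s in `[M, +oo[) (maxe (H Phi s) 0 * (s ^- 2)%:E))).
  rewrite (eq_integral (cst +oo)).
    by rewrite integral_cst//= lebesgue_measure_itv/= ltry addye// mulyy.
  move=> s; rewrite inE/= in_itv/= andbT => Ms.
  have Ts : (T <= s)%R by apply: le_trans Ms; rewrite le_max lexx.
  have s0 : (0 < s)%R by rewrite (lt_le_trans D0)// (le_trans DM).
  have -> : H Phi s = +oo by apply/eqP; rewrite -leye_eq -HT H_nd.
  by rewrite max_l// gt0_mulye// lte_fin invr_gt0 exprn_gt0.
apply: ge0_subset_integral => //.
- by apply: measurable_logtail => //; apply: measurable_H_itv; exact: ltW.
- by move=> x _; rewrite mule_ge0.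
- by move=> x /=; rewrite !in_itv/= !andbT; exact: le_trans.
Qed.

Lemma integral_invsq_itv (a : R) (k : R) : (0 < a)%R -> (0 <= k)%R ->
  \int[leb]_(s in `[a, +oo[) (k%:E * (s ^- 2)%:E) < +oo.
Proof.
move=> a0 k0; rewrite ge0_integralZl//; last exact: measurable_invsq.
by rewrite integral_invsq_c// -EFinM ltry.
Qed.

(** Lowering the base point can only increase the integral. When it is raised from [D] to [D'], the
    lost piece is at most the integral of [k / s^2], with [k] the positive part of H at [D']; if
    that value is infinite, the tail diverges anyway. *)
Lemma logtail_indep (D D' : R) : (0 < D)%R -> (0 < D')%R ->
  logtail D = +oo -> logtail D' = +oo.
Proof.
move=> D0 D'0 tD.
have mD (E : R) : (0 < E)%R -> measurable_fun (`[E, +oo[ : set R) (fun s => maxe (H Phi s) 0 * (s ^- 2)%:E).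
  by move=> /ltW E0; apply: measurable_logtail => //; exact: measurable_H_itv.
have p s : 0 <= maxe (H Phi s) 0 * (s ^- 2)%:E by rewrite mule_ge0.
have [D'D|/ltW DD'] := leP D' D.
  apply/eqP; rewrite -leye_eq -tD; apply: ge0_subset_integral => //.
    exact: mD.
  by move=> x /=; rewrite !in_itv/= !andbT; exact: le_trans.
have [HD'|HD'] := eqVneq (H Phi D') +oo.
  by apply: (@logtail_y D') => //; exact: ltW.
move: tD; rewrite {1}/logtail.
rewrite (@itv_bndbnd_setU _ _ (BLeft D) (BLeft D') +oo%O); last 2 first.
  by rewrite bnd_simp.
  by [].
rewrite ge0_integral_setU//; last 2 first.
- by rewrite -itv_bndbnd_setU ?bnd_simp//; exact: mD.
- by apply/disj_setPS => x [] /=; rewrite !in_itv/= andbT => /andP[_ xD'] /(lt_le_trans xD'); rewrite ltxx.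
apply: ltey_adde_eqy.
pose k := fine (maxe (H Phi D') 0).
have HD'k : maxe (H Phi D') 0 = k%:E.
  by rewrite /k fineK// ge0_fin_numE// gt_max ltey HD' ltry.
apply: (le_lt_trans _ (@integral_invsq_itv D k D0 _)); last first.
  by rewrite -lee_fin -HD'k.
apply: (@le_trans _ _ (\int[leb]_(s in `[D, D'[) (k%:E * (s ^- 2)%:E))).
  apply: le_lower_integral => x; first by rewrite mule_ge0.
  rewrite /= in_itv/= => /andP[Dx xD']; rewrite lee_wpmul2r// -HD'k.
  rewrite ge_max maxe0_ge0 andbT le_max (H_nd _ _ _ (ltW xD'))//.
  by rewrite (le_trans (ltW D0)).
apply: ge0_subset_integral => //.
- by apply: measurable_funeM; exact: measurable_invsq.
- by move=> x _; rewrite mule_ge0// -HD'k.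
- by move=> x /=; rewrite !in_itv/= andbT => /andP[].
Qed.

(** Since [H <= c] up to [a], the excess only collects mass from [a] on. There the positive parts of
    H and of [H - c] differ by at most [|c|], and [|c| / s^2] is integrable. *)
Lemma excessP (a c : R) : (0 < a)%R -> H Phi a <= c%:E ->
  excess c = +oo <-> logtail 1 = +oo.
Proof.
move=> a0 Hac.
have mH := @measurable_H_itv a (ltW a0).
have -> : excess c = \int[leb]_(s in `[a, +oo[) (maxe (H Phi s - c%:E) 0 * (s ^- 2)%:E).
  rewrite /excess (@itv_bndbnd_setU _ _ (BRight 0%R) (BLeft a) +oo%O) ?bnd_simp//.
  rewrite ge0_integral_setU//; last 3 first.
  - rewrite -itv_bndbnd_setU ?bnd_simp//.
    by apply: measurable_excess => //; exact: measurable_H_pos.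
  - by move=> s _; rewrite mule_ge0.
  - by apply/disj_setPS => x [] /=; rewrite !in_itv/= andbT => /andP[_ xa] /(lt_le_trans xa); rewrite ltxx.
  rewrite integral0_eq ?add0e// => s /=; rewrite in_itv/= => /andP[s0 sa].
  rewrite max_r ?mul0e//.
  rewrite EFinN leeBlDr// add0e (le_trans _ Hac)//.
  by apply: H_nd; exact: ltW.
have mk (k : R) : measurable_fun `[a, +oo[ (fun s => k%:E * (s ^- 2)%:E).
  by apply: measurable_funeM; exact: measurable_invsq.
have fink (f g : R -> \bar R) : measurable_fun `[a, +oo[ f -> (forall s, 0 <= f s) ->
   (forall s, g s <= f s + `|c|%:E) -> (forall s, 0 <= g s) ->
   \int[leb]_(s in `[a, +oo[) (g s * (s ^- 2)%:E) = +oo ->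
   \int[leb]_(s in `[a, +oo[) (f s * (s ^- 2)%:E) = +oo.
  move=> mf f0 gf g0 gy.
  have : \int[leb]_(s in `[a, +oo[) (f s * (s ^- 2)%:E + `|c|%:E * (s ^- 2)%:E) = +oo.
    apply/eqP; rewrite -leye_eq -gy; apply: le_lower_integral => s _.
      by rewrite mule_ge0.
    by rewrite -ge0_muleDl ?lee_fin// lee_wpmul2r.
  rewrite ge0_integralD; first last.
  - exact: mk.
  - by move=> s _; rewrite mule_ge0// lee_fin.
  - by apply: emeasurable_funM => //; exact: measurable_invsq.
  - by move=> s _; rewrite mule_ge0.
  - exact: measurable_itv.
  by rewrite addeC; apply: ltey_adde_eqy; exact: integral_invsq_itv.
have cc : (c%:E <= `|c|%:E)%E by rewrite lee_fin ler_norm.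
have cNc : (- c%:E <= `|c|%:E)%E by rewrite -EFinN lee_fin ler_normr lexx orbT.
split => [h|h].
  apply: (@logtail_indep a) => //; move: h; apply: fink => //.
  - by apply: measurable_maxe.
  - move=> s; rewrite ge_max; apply/andP; split.
      by rewrite leeD// le_max lexx.
    by rewrite adde_ge0 ?lee_fin.
have {}h : logtail a = +oo by exact: (@logtail_indep 1).
move: h; apply: fink => //.
- by apply: measurable_maxe => //; exact: emeasurable_funB.
- move=> s; rewrite ge_max; apply/andP; split; last by rewrite adde_ge0 ?lee_fin.
  apply: (@le_trans _ _ (H Phi s - c%:E + `|c|%:E)); last first.
    by rewrite leeD2r// le_max lexx.
  rewrite -addeA leeDl// -EFinN -EFinD lee_fin addrC subr_ge0 ler_norm//.
Qed.

End logtail.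

(** The negative part of [f] is dominated by [g], hence has a finite integral, and the positive part
    alone decides divergence. *)
Lemma integral_eqy_funepos d (T : measurableType d) (R : realType)
    (m : {measure set T -> \bar R}) (A : set T) (f g : T -> \bar R) :
  (forall x, A x -> - g x <= f x) -> (forall x, A x -> 0 <= g x) ->
  \int[m]_(x in A) g x < +oo ->
  \int[m]_(x in A) f x = +oo <-> \int[m]_(x in A) maxe (f x) 0 = +oo.
Proof.
move=> gf g0 ig.
have : \int[m]_(x in A) f^\- x < +oo.
  apply: le_lt_trans ig; apply: le_lower_integral => x Ax; first exact: funeneg_ge0.
  by rewrite funenegE ge_max g0// andbT leeNl gf.
have : 0 <= \int[m]_(x in A) f^\- x.
  by apply: integral_ge0 => x _; exact: funeneg_ge0.
rewrite [in X in _ -> _ -> X <-> _]integralE.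
rewrite (eq_integral (fun x => maxe (f x) 0) (f^\+)); last by move=> x _; rewrite funeposE.
case: (\int[m]_(x in A) f^\- x) => [r| |]// _ _.
by case: (\int[m]_(x in A) maxe _ _) => [s| |] /=.
Qed.

(** * Conditions (c) and (e) *)

Section conditions_c_e_f.
Context {R : realType}.
Variable Phi : R -> \bar R.
Hypotheses (nn : nonneg0 Phi) (nd : nondecreasing0 Phi).
Hint Resolve invsq_ge0 maxe0_ge0 : core.

Lemma t0_lt (D : R) : t0 Phi < D%:E -> (0 < D)%R /\ 0 < Phi D.
Proof.
move=> tD.
have D0 : (0 < D)%R.
  by rewrite -lte_fin; apply: le_lt_trans tD; apply: ereal_sup_ubound; right.
split => //; rewrite lt0e nn ?(ltW D0)// andbT; apply/eqP => PD.
suff : D%:E <= t0 Phi by rewrite leNgt tD.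
by apply: ereal_sup_ubound; left; exists D => //; split => //; exact: ltW.
Qed.

(** A divergent tail forces [Phi] to be positive at some [s >= 1], and by monotonicity no zero lies
    beyond [s]. This supplies the admissible base point required by (b), (c) and (d). *)
Lemma logtail_t0 : logtail Phi 1 = +oo -> exists D, t0 Phi < D%:E.
Proof.
move=> ly.
have [s s1 Ps] : exists2 s : R, (1 <= s)%R & 0 < Phi s.
  apply: contrapT => nex; move: ly; rewrite /logtail integral0_eq// => s /=.
  rewrite in_itv/= andbT => s1; rewrite /H le0_lneNy.
    by rewrite max_r ?leNye// mul0e.
  by rewrite leNgt; apply/negP => Ps; apply: nex; exists s.
exists (s + 1)%R; apply: (@le_lt_trans _ _ s%:E); last first.
  by rewrite lte_fin ltrDl.
have s0 : (0 <= s)%R by exact: le_trans s1.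
apply: ge_ereal_sup => _ [[t [t0 Pt] <-]| ->]; rewrite lee_fin//.
rewrite leNgt; apply/negP => st; move: Ps; rewrite ltNge; apply/negP.
by rewrite negbK -Pt nd// ltW.
Qed.

Lemma H_ge_fin (D : R) : 0 < Phi D -> exists2 k : R, (0 <= k)%R & - k%:E <= H Phi D.
Proof.
rewrite /H; case: (Phi D) => [r| |]//=; last by move=> _; exists 0%R; rewrite ?leey.
rewrite lte_fin => r0; rewrite leNgt r0/=.
by exists `|ln r|%R => //; rewrite lee_fin lerNl ler_normr lexx orbT.
Qed.

(** From [D] on, H is bounded below by a constant [-k], and [k / s^2] is integrable there. *)
Lemma integral_H_tail (D : R) : (0 < D)%R -> 0 < Phi D ->
  \int[leb]_(s in `[D, +oo[) (H Phi s * (s ^- 2)%:E) = +oo <-> logtail Phi D = +oo.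
Proof.
move=> D0 PD.
have [k k0 Hk] := H_ge_fin _ PD.
rewrite (@integral_eqy_funepos _ (measurableTypeR R) R leb _ _ (fun s : R => k%:E * (s ^- 2)%:E)).
- suff -> : \int[leb]_(s in `[D, +oo[) maxe (H Phi s * (s ^- 2)%:E) 0 = logtail Phi D by [].
  by apply: eq_integral => s _; rewrite maxe_pMl ?mul0e//; exact: invsq_ge0.
- move=> s Ds; have {}Ds : (D <= s)%R by move: Ds; rewrite /= in_itv/= andbT.
  rewrite -mulNe lee_wpmul2r ?invsq_ge0// (le_trans Hk)// H_nd// ltW//.
- by move=> s _; rewrite mule_ge0 ?invsq_ge0// lee_fin.
- exact: integral_invsq_itv.
Qed.

Lemma cond_cP : cond_c Phi <-> logtail Phi 1 = +oo.
Proof.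
split=> [[D [/t0_lt[D0 PD]]]|ly].
  by rewrite integral_H_tail// => h; apply: logtail_indep h.
have [D tD] := logtail_t0 ly; exists D; split => //.
have [D0 PD] := t0_lt _ tD.
by rewrite integral_H_tail//; apply: logtail_indep ly.
Qed.

Lemma Hinv_nd (a b : R) : (a <= b)%R -> Hinv Phi a <= Hinv Phi b.
Proof.
move=> ab; apply: le_ereal_inf => _ [t [t0 bt] <-]; exists t => //; split => //.
by apply: le_trans bt; rewrite lee_fin.
Qed.

(** Some [t > 0] has [H t < c], and [t] then bounds the defining set from below. The strict
    inequality with [H(+0)] thus keeps the integrand [1 / Hinv] away from a division by zero. *)
Lemma Hinv_gt0 (c : R) : Hp0 Phi < c%:E -> 0 < Hinv Phi c.
Proof.
move=> /ereal_inf_lt[_ [t /= + <-]]; rewrite in_itv/= andbT => t0 Htc.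
apply: (@lt_le_trans _ _ t%:E); first by rewrite lte_fin.
apply: le_ereal_inf_tmp => _ [u [u0 cu] <-]; rewrite lee_fin leNgt.
apply/negP => ut; move: Htc; rewrite ltNge => /negP; apply.
by rewrite (le_trans cu)// H_nd// ltW.
Qed.

Lemma Hinv_le (c s : R) : (0 <= s)%R -> c%:E <= H Phi s -> Hinv Phi c <= s%:E.
Proof. by move=> s0 cs; apply: ereal_inf_lbound; exists s. Qed.

(** A converse of [Hinv_le], with a strict inequality because the infimum need not be attained when
    H jumps. The cut at [s / 2] in the upper tail estimate provides this strictness. *)
Lemma le_H_of_Hinv_lt (c s : R) : Hinv Phi c < s%:E -> c%:E <= H Phi s.
Proof.
move=> /ereal_inf_lt[_ [t [t0 ct] <-]]; rewrite lte_fin => ts.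
by rewrite (le_trans ct)// H_nd// ltW.
Qed.

Lemma measurable_Hinv (D : set R) : measurable D -> measurable_fun D (Hinv Phi).
Proof.
move=> mD; apply: (measurable_funS measurableT) => //.
by apply: emeasurable_fun_nd => // s t _ _; exact: Hinv_nd.
Qed.

Lemma Phiinv_Hinv (tau : R) : (0 < tau)%R -> Phiinv Phi tau = Hinv Phi (ln tau).
Proof.
move=> t0; rewrite /Phiinv /Hinv; congr ereal_inf; congr (_ @` _).
apply/seteqP; split => t [tt0 h]; split => //; move: h; rewrite /H -lne_EFin//;
  by rewrite lee_lne// in_itv/= ?nn//= ?leey// lee_fin ltW.
Qed.

(* The map [e] reparametrizes the range of H: the identity for (e), the logarithm for (f). *)
Lemma integral_erecip_Hinv (A : set R) (w e : R -> R) (c : R) :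
  measurable A -> measurable_fun A w -> (forall x, A x -> (0 <= w x)%R) ->
  measurable_fun A e -> (forall x, A x -> Hp0 Phi < (e x)%:E) -> Hp0 Phi < c%:E ->
  (forall y : \bar R, \int[leb]_(x in A `&` [set x | (e x)%:E <= y]) (w x)%:E = maxe (y - c%:E) 0) ->
  \int[leb]_(x in A) ((w x)%:E * erecip (Hinv Phi (e x))) = +oo <-> logtail Phi 1 = +oo.
Proof.
move=> mA mw w0 me eA cH we.
have [a a0 Hac] : exists2 a : R, (0 < a)%R & H Phi a <= c%:E.
  move: cH => /ereal_inf_lt[_ [a /= + <-]]; rewrite in_itv/= andbT => a0 /ltW h.
  by exists a.
rewrite -(@excessP _ _ nn nd _ _ a0 Hac).
have mHe : measurable_fun A (fun x => Hinv Phi (e x)).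
  by apply: (measurableT_comp (measurable_Hinv _ measurableT)).
have mw' : measurable_fun A (EFin \o w) by exact/measurable_EFinP.
have He0 x : A x -> 0 < Hinv Phi (e x) by move=> Ax; apply/Hinv_gt0/eA.
have w0' x : A x -> 0 <= (w x)%:E by move=> Ax; rewrite lee_fin w0.
have mS (y : \bar R) : measurable (A `&` [set x | (e x)%:E <= y]).
  by apply: emeasurable_fun_infty_c => //; exact/measurable_EFinP.
have mT (s : R) : measurable (A `&` [set x | Hinv Phi (e x) <= s%:E]).
  exact: emeasurable_fun_infty_c.
split=> h; apply/eqP; rewrite -leye_eq.
- have : \int[leb]_(x in A) ((w x)%:E * erecip (Hinv Phi (e x))) <= 2%:E * excess Phi c.
    apply: (@integral_erecip_le_tail _ _ R leb) => //.
    move=> s s0; rewrite -we.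
    apply: ge0_subset_integral; [exact: mT|exact: mS| | |].
      by apply: (measurable_funS mA _ mw') => x [].
      by move=> x [Ax _]; exact: w0'.
    move=> x [Ax /= Hx]; split => //=; apply: le_H_of_Hinv_lt.
    by apply: (le_lt_trans Hx); rewrite lte_fin ltr_pdivrMr// ltr_pMr// ltr1n.
  rewrite h; case: (excess Phi c) => [r| |]//.
  by rewrite gt0_muleNy ?lte_fin.
- rewrite -h; apply: (@le_tail_integral_erecip _ _ R leb _ (EFin \o w)) => //.
  move=> s s0; rewrite -we.
  apply: ge0_subset_integral; [exact: mS|exact: mT| | |].
    by apply: (measurable_funS mA _ mw') => x [].
    by move=> x [Ax _]; exact: w0'.
  by move=> x [Ax /= Hx]; split => //=; apply: Hinv_le => //; exact: ltW.
Qed.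

(** If [Phi(+0)] were infinite, no real lower limit would exceed [H(+0)] and (e) would fail,
    although the tail diverges. Otherwise the weight is 1, and the inner integral is the length of
    [[Ds, y]]. *)
Lemma cond_eP : Phip0 Phi < +oo -> cond_e Phi <-> logtail Phi 1 = +oo.
Proof.
move=> Py.
have Hy : Hp0 Phi < +oo.
  move: Py => /ereal_inf_lt[_ [a /= a0 <-]] Pa.
  apply: (@le_lt_trans _ _ (H Phi a)).
    by apply: ereal_inf_lbound; exists a.
  by move: Pa; rewrite /H; case: (Phi a) => [r| |]//= _; case: ifP; rewrite ?ltry.
have E (Ds : R) : Hp0 Phi < Ds%:E ->
    \int[leb]_(eta in `[Ds, +oo[) erecip (Hinv Phi eta) = +oo <-> logtail Phi 1 = +oo.
  move=> HD.
  rewrite -(@integral_erecip_Hinv `[Ds, +oo[ (cst 1%R) id Ds)//.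
  - by under [in X in _ <-> X]eq_integral do rewrite mul1e.
  - move=> x /=; rewrite in_itv/= andbT => Dx.
    by apply: (lt_le_trans HD); rewrite lee_fin.
  - move=> y; rewrite (eq_integral (cst 1))// integral_cst// ?mul1e; last first.
      by apply: emeasurable_fun_infty_c => //; exact/measurable_EFinP.
    case: y => [r| |].
    + rewrite (_ : _ `&` _ = `[Ds, r]%classic); last first.
        by apply/seteqP; split => x /=; rewrite !in_itv/= ?andbT lee_fin; [case=> -> ->|move=> /andP[]].
      rewrite /= lebesgue_measure_itv/= lte_fin -EFinD; case: ltP => h.
        by rewrite max_l// lee_fin subr_ge0 ltW.
      by rewrite max_r// lee_fin subr_le0.
    + rewrite (_ : _ `&` _ = `[Ds, +oo[%classic); last first.
        by apply/seteqP; split => x /=; rewrite !in_itv/= ?andbT leey; [case|].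
      by rewrite /= lebesgue_measure_itv/= ltry addye// max_l// leey.
    + rewrite (_ : _ `&` _ = set0) ?measure0 ?max_r ?leNye//.
      by apply/seteqP; split => x //= [_]; rewrite leeNy_eq.
split=> [[Ds [HD /E]]|ly]; first exact.
have [c Hc] : exists c : R, Hp0 Phi < c%:E.
  move: Hy; case: (Hp0 Phi) => [r| |]// _; last by exists 0%R; rewrite ltNyr.
  by exists (r + 1)%R; rewrite lte_fin ltrDl.
by exists c; split => //; apply/E.
Qed.

End conditions_c_e_f.

(** * Condition (f) *)

Lemma integral_inv_itv (R : realType) (a b : R) : (0 < a)%R -> (a < b)%R ->
  \int[leb]_(x in `[a, b]) (x^-1)%:E = (ln b - ln a)%:E.
Proof.
move=> a0 ab.
have dln (x : R) : (0 < x)%R -> is_derive x 1%R (@ln R) (x^-1)%R.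
  exact: is_derive1_ln.
have cln (x : R) : (0 < x)%R -> {for x, continuous (@ln R)}.
  exact: continuous_ln.
rewrite (@continuous_FTC2 _ _ (@ln R))//.
- apply: continuous_in_subspaceT => x; rewrite inE/= in_itv/= => /andP[ax _].
  by apply: inv_continuous; rewrite gt_eqF// (lt_le_trans a0).
- split.
  + move=> x; rewrite in_itv/= => /andP[ax _].
    by have [] := dln x (lt_trans a0 ax).
  + by apply: cvg_at_right_filter; exact: cln.
  + by apply: cvg_at_left_filter; apply: cln; exact: lt_trans ab.
- move=> x; rewrite in_itv/= => /andP[ax _].
  by rewrite derive1E; have /@derive_val := dln x (lt_trans a0 ax).
Qed.

Section conditions_f_d.
Context {R : realType}.
Variable Phi : R -> \bar R.
Hypotheses (nn : nonneg0 Phi) (nd : nondecreasing0 Phi).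

Lemma cond_fP : Phip0 Phi < +oo -> cond_f Phi <-> logtail Phi 1 = +oo.
Proof.
move=> Py.
have P0 : 0 <= Phip0 Phi.
  apply: le_ereal_inf_tmp => _ [t /= + <-]; rewrite in_itv/= andbT => /ltW.
  exact: nn.
have E (ds : R) : Phip0 Phi < ds%:E ->
    \int[leb]_(tau in `[ds, +oo[) erecip (tau%:E * Phiinv Phi tau) = +oo <-> logtail Phi 1 = +oo.
  move=> Pd; have d0 : (0 < ds)%R by rewrite -lte_fin (le_lt_trans P0).
  have pos (x : R) : (`[ds, +oo[%classic : set R) x -> (0 < x)%R.
    by rewrite /= in_itv/= andbT; exact: lt_le_trans.
  have Hc : Hp0 Phi < (ln ds)%:E.
    move: Pd => /ereal_inf_lt[_ [t /= + <-]]; rewrite in_itv/= andbT => t0 Pt.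
    apply: (@le_lt_trans _ _ (H Phi t)).
      by apply: ereal_inf_lbound; exists t => //=; rewrite in_itv/= t0.
    by rewrite -lne_EFin// lte_lne// in_itv/= ?nn ?leey//= ?ltW// lee_fin ltW.
  have -> : \int[leb]_(tau in `[ds, +oo[) erecip (tau%:E * Phiinv Phi tau) =
      \int[leb]_(tau in `[ds, +oo[) ((tau^-1)%:E * erecip (Hinv Phi (ln tau))).
    apply: eq_integral => tau /set_mem /pos tau0; rewrite Phiinv_Hinv//.
    case: (Hinv Phi (ln tau)) => [r| |] /=.
    - by rewrite -EFinM invfM.
    - by rewrite gt0_muley ?lte_fin// mule0.
    - by rewrite gt0_muleNy ?lte_fin// mule0.
  have mS (y : \bar R) : measurable ((`[ds, +oo[ : set R) `&` [set x | (ln x)%:E <= y]).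
    apply: emeasurable_fun_infty_c => //; apply/measurable_EFinP.
    exact: measurable_funTS (@measurable_ln R).
  (* The set is [[ds, exp r]], whose mass for [dx / x] is [r - ln ds] when it is nonempty: the
     logarithm carries this measure to Lebesgue measure. *)
  have key (r : R) : \int[leb]_(x in `[ds, +oo[ `&` [set x | (ln x)%:E <= r%:E]) (x^-1)%:E =
      maxe (r%:E - (ln ds)%:E) 0.
    rewrite (_ : _ `&` _ = `[ds, expR r]%classic); last first.
      apply/seteqP; split => x /=; rewrite !in_itv/= ?andbT lee_fin.
        by move=> [dx xr]; rewrite dx/= -(@lnK _ x) ?ler_expR// posrE (lt_le_trans d0).
      move=> /andP[dx xr]; split => //.
      by rewrite -(@expRK _ r) ler_ln// posrE ?expR_gt0// (lt_le_trans d0).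
    have [h|h|h] := ltgtP ds (expR r).
    - by rewrite integral_inv_itv// expRK -EFinD max_l// lee_fin subr_ge0
        -ler_expR lnK ?ltW.
    - rewrite set_itv_ge ?bnd_simp -?ltNge// integral_set0 -EFinD max_r//.
      by rewrite lee_fin subr_le0 -ler_expR lnK ?posrE// ltW.
    - by rewrite -h set_itv1 integral_set1 h expRK subee// maxxx.
  apply: (@integral_erecip_Hinv _ _ nn nd _ (fun x => x^-1)%R (@ln R) (ln ds)) => //.
  - exact: measurable_invr.
  - by move=> x /pos/ltW; rewrite invr_ge0.
  - exact: measurable_funTS (@measurable_ln R).
  - move=> x dx; apply: (lt_le_trans Hc); rewrite lee_fin ler_ln ?posrE//; last exact: pos.
    by move: dx; rewrite /= in_itv/= andbT.
  - case=> [r| |]; first exact: key.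
    (* For [y = +oo] the mass exceeds every [M > 0], by [key] at the level [M + ln ds]. *)
    + rewrite addye// max_l ?leey//; apply/eqyP => M M0.
      have := key (M + ln ds)%R; rewrite -EFinD addrK max_l ?lee_fin ?(ltW M0)// => <-.
      apply: ge0_subset_integral; [exact: mS|exact: mS| | |].
      * apply/measurable_EFinP; exact: measurable_invr.
      * by move=> x [/pos/ltW x0 _]; rewrite lee_fin invr_ge0.
      * by move=> x /= [dx _]; split => //; rewrite leey.
    + rewrite (_ : _ `&` _ = set0) ?integral_set0 ?max_r ?leNye//.
      by apply/seteqP; split => x //= [_]; rewrite leeNy_eq.
split=> [[Ds [HD /E]]|ly]; first exact.
have [c Hc] : exists c : R, Phip0 Phi < c%:E.
  move: Py P0; case: (Phip0 Phi) => [r| |]// _ _.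
  by exists (r + 1)%R; rewrite lte_fin ltrDl.
by exists c; split => //; apply/E.
Qed.

End conditions_f_d.

(** * The substitution [t = 1 / s] and condition (d) *)

Lemma le_inv_swap (R : realType) (x y : R) : (0 < x)%R -> (0 < y)%R ->
  (x <= y^-1)%R = (y <= x^-1)%R.
Proof. by move=> x0 y0; rewrite -[in RHS](invrK y) lef_pV2// posrE invr_gt0. Qed.

(** Each value [k s] is written as the length of the set of [y >= 0] with [y < k s]. After Tonelli,
    it remains to compare, for every [y], the length of the set where [y < k (1/t)] with the mass
    for [ds / s^2] of the set where [y < k s]. *)
Lemma integral_inv_subst (R : realType) (D : R) (k : R -> \bar R) :
  (0 < D)%R -> (forall s, (D <= s)%R -> 0 <= k s) ->
  (forall s t, (D <= s)%R -> (s <= t)%R -> k s <= k t) ->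
  \int[leb]_(t in `]0%R, (D^-1)%R]) k (t^-1)%R = \int[leb]_(s in `[D, +oo[) (k s * (s ^- 2)%:E).
Proof.
move=> D0 k0 ndk.
pose B : set (measurableTypeR R) := `[0%R, +oo[%classic.
pose k' := k \_ (`[D, +oo[ : set R).
pose E : set (measurableTypeR R * measurableTypeR R) := [set z | (z.2%:E < k' z.1)].
have mk : measurable_fun (`[D, +oo[ : set R) k.
  apply: emeasurable_fun_nd; first exact: interval_is_interval.
  by move=> s t /=; rewrite !in_itv/= !andbT => Ds _; exact: ndk.
have mk' : measurable_fun (setT : set R) k' by exact: (measurable_restrictT _ _).1.
have mE : measurable E.
  rewrite -[E]setTI; apply: measurable_lte => //; first exact/measurable_EFinP.
  exact: (measurableT_comp mk').
have kE (s : R) : (D <= s)%R -> k s = \int[leb]_(eta in B `&` [set eta | E (s, eta)]) 1.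
  move=> Ds; rewrite (_ : _ `&` _ = [set` Interval (BLeft 0%R) (if k s is r%:E then BLeft r else +oo%O)]).
    rewrite integral_cst//= mul1e.
    have := k0 _ Ds; case: (k s) => [r| |]//=; rewrite ?lee_fin => r0.
      rewrite lebesgue_measure_itv/= lte_fin sube0; case: ltgtP r0 => //.
      by move=> <-.
    by rewrite lebesgue_measure_itv/= ltry sube0.
  have k'E : k' s = k s by rewrite /k' patchE mem_set//= in_itv/= Ds.
  apply/seteqP; split => x; rewrite /B /E /= k'E; have := k0 _ Ds;
    case: (k s) => [r| |]//= _; rewrite !in_itv/= ?andbT ?lte_fin.
  - by case=> -> ->.
  - by case.
  - by move=> /andP[].
  - by move=> x0; rewrite ltry.
pose E' : set (measurableTypeR R * measurableTypeR R) := [set z | z.2%:E < k' (z.1^-1)%R].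
have mE' : measurable E'.
  rewrite -[E']setTI; apply: measurable_lte => //; first exact/measurable_EFinP.
  apply: (measurableT_comp mk').
  by apply: (@measurableT_comp _ _ _ _ _ _ (fun x : R => x^-1)%R) => //; exact: measurable_invr.
have mq : measurable_fun (`[D, +oo[ : set (measurableTypeR R)) (fun s : R => (s ^- 2)%:E).
  exact: measurable_invsq.
have q0 (s : R) : 0 <= (s ^- 2)%:E by rewrite lee_fin invr_ge0 sqr_ge0.
transitivity (\int[leb]_(t in `]0%R, (D^-1)%R]) (1 * \int[leb]_(y in B `&` [set y | E' (t, y)]) 1)).
  apply: eq_integral => t; rewrite inE/= in_itv/= => /andP[t0 tD].
  by rewrite mul1e kE// -le_inv_swap.
transitivity (\int[leb]_(s in `[D, +oo[) ((s ^- 2)%:E * \int[leb]_(y in B `&` [set y | E (s, y)]) 1)); last first.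
  apply: eq_integral => s; rewrite inE/= in_itv/= andbT => Ds.
  by rewrite muleC -kE.
have T1 := @tonelli_relation _ _ (measurableTypeR R) (measurableTypeR R) R leb leb
  `]0%R, (D^-1)%R]%classic B (cst 1) (cst 1) E' (measurable_itv _) (measurable_itv _) mE'
  (measurable_cst _) (measurable_cst _) (fun=> fun=> lee01) (fun=> fun=> lee01).
have T2 := @tonelli_relation _ _ (measurableTypeR R) (measurableTypeR R) R leb leb
  `[D, +oo[%classic B (fun s : R => (s ^- 2)%:E) (cst 1) E (measurable_itv _) (measurable_itv _) mE
  mq (measurable_cst _) (fun x _ => q0 x) (fun=> fun=> lee01).
apply: (etrans T1); apply: (etrans _ (esym T2)).
clear T1 T2.
apply: eq_integral => y _; congr *%E.
pose U : set R := `[D, +oo[%classic `&` [set s | y%:E < k s].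
have k'E (x : R) : (D <= x)%R -> k' x = k x.
  by move=> Dx; rewrite /k' patchE mem_set//= in_itv/= Dx.
have -> : `[D, +oo[ `&` [set x | E (x, y)] = U.
  apply/seteqP; split => x [Dx h]; (split; first exact: Dx); move: (Dx) h;
    by rewrite /= in_itv/= andbT => Dx'; rewrite /E/= k'E.
have -> : `]0%R, (D^-1)%R] `&` [set x | E' (x, y)] = [set t : R | (0 < t)%R /\ U (t^-1)%R].
  apply/seteqP; split => x.
    move=> [+ +]; rewrite /= in_itv/= => /andP[x0 xD].
    have Dx : (D <= x^-1)%R by rewrite -le_inv_swap.
    rewrite /E'/= k'E// => h.
    by split; [exact: x0|split; [rewrite /= in_itv/= andbT|exact: h]].
  move=> [x0 [+ +]]; rewrite /= in_itv/= andbT => Dx.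
  have xD : (x <= D^-1)%R by rewrite le_inv_swap.
  by move=> yk; split; [rewrite /= in_itv/= x0|rewrite /E'/= k'E].
have [Ue|/nonemptyPn U0] := pselect (U !=set0); last first.
  rewrite U0 integral_set0 (_ : [set t | _] = set0) ?integral_set0//.
  by apply/seteqP; split => // x [_].
have hU : has_inf U by split => //; exists D => x []/=; rewrite in_itv/= andbT.
(* By monotonicity [U] is a ray with end point [b], which it may or may not contain. In either case
   both masses are squeezed to [1 / b]. *)
pose b := inf U.
have Db : (D <= b)%R by apply: lb_le_inf => // x [] /=; rewrite in_itv/= andbT.
have b0 : (0 < b)%R by exact: lt_le_trans Db.
have Ub (s : R) : U s -> (b <= s)%R by move=> Us; apply: ge_inf => //; exact: hU.2.
have bU (s : R) : (b < s)%R -> U s.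
  move=> bs; have [u [Du yu] us] := inf_lt Ue bs.
  move: Du; rewrite /= in_itv/= andbT => Du.
  split; first by rewrite /= in_itv/= andbT (le_trans Du)// ltW.
  by apply: (lt_le_trans yu); apply: ndk => //; exact: ltW.
have upU (s u : R) : U s -> (s <= u)%R -> U u.
  move=> [/=]; rewrite /U/= !in_itv/= !andbT => Ds ys su.
  by split; [exact: le_trans su|apply: (lt_le_trans ys); exact: ndk].
have mU : measurable U.
  by apply: is_interval_measurable => s t Us _ u /andP[su _]; exact: (upU _ _ Us su).
pose V : set R := [set t : R | (0 < t)%R /\ U (t^-1)%R].
have mV : measurable V.
  apply: is_interval_measurable => s t [s0 _] [t0 Ut] u /andP[su ut].
  have u0 := lt_le_trans s0 su.
  by split => //; apply: (upU _ _ Ut); rewrite lef_pV2.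
have lebc (c : R) : (0 < c)%R -> \int[leb]_(x in `]0%R, c]) cst 1 x = c%:E.
  by move=> c0; rewrite integral_cst//= lebesgue_measure_itv/= lte_fin c0 sube0 mul1e.
have lebo (c : R) : (0 < c)%R -> \int[leb]_(x in `]0%R, c[) cst 1 x = c%:E.
  by move=> c0; rewrite integral_cst//= lebesgue_measure_itv/= lte_fin c0 sube0 mul1e.
apply/eqP; rewrite eq_le; apply/andP; split.
- apply: (@le_trans _ _ (b^-1)%:E).
    rewrite -(lebc (b^-1)%R) ?invr_gt0//; apply: ge0_subset_integral => //.
    move=> x [x0 /Ub bx]; rewrite /= in_itv/= x0/=.
    by rewrite le_inv_swap.
  rewrite -integral_invsq_c// -integral_itv_obnd_cbnd; last exact: measurable_invsq.
  apply: ge0_subset_integral => //; first exact: measurable_invsq.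
  by move=> x /=; rewrite in_itv/= andbT; exact: bU.
- apply: (@le_trans _ _ (b^-1)%:E).
    rewrite -integral_invsq_c//; apply: ge0_subset_integral => //; first exact: measurable_invsq.
    by move=> x /Ub; rewrite /= in_itv/= andbT.
  rewrite -(lebo (b^-1)%R) ?invr_gt0//; apply: ge0_subset_integral => //.
  move=> x; rewrite /= in_itv/= => /andP[x0 xb]; split => //; apply: bU.
  by rewrite -[ltLHS]invrK ltf_pV2 ?posrE ?invr_gt0.
Qed.

Section conditions_d_b.
Context {R : realType}.
Variable Phi : R -> \bar R.
Hypotheses (nn : nonneg0 Phi) (nd : nondecreasing0 Phi).

(** The interval []0, 1/D]] has finite length, so the lower bound [-k] of H costs only a finite
    amount; the substitution is applied to the positive part. *)
Lemma integral_Hinvr (D : R) : (0 < D)%R -> 0 < Phi D ->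
  \int[leb]_(t in `]0%R, (D^-1)%R]) H Phi (t^-1)%R = +oo <-> logtail Phi D = +oo.
Proof.
move=> D0 PD; have [k k0 Hk] := H_ge_fin _ _ PD.
have -> : logtail Phi D = \int[leb]_(t in `]0%R, (D^-1)%R]) maxe (H Phi (t^-1)%R) 0.
  rewrite (@integral_inv_subst R D (fun s => maxe (H Phi s) 0))//.
  + by move=> s _; rewrite maxe0_ge0.
  + move=> s t Ds st; rewrite ge_max maxe0_ge0 andbT le_max H_nd//.
    by rewrite (le_trans (ltW D0)).
apply: (@integral_eqy_funepos _ (measurableTypeR R) R leb _ _ (cst k%:E)).
- move=> t; rewrite /= in_itv/= => /andP[t0 tD].
  have Dt : (D <= t^-1)%R by rewrite -le_inv_swap.
  by rewrite (le_trans Hk)// H_nd// ltW.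
- by move=> t _; rewrite lee_fin.
- by rewrite integral_cst//= lebesgue_measure_itv/= lte_fin invr_gt0 D0 sube0 -EFinM ltry.
Qed.

(** The product form of [d < 1 / t0] also covers [t0 = 0], where the bound is infinite. *)
Lemma mul_t0_lt1 (D : R) : (0 < D)%R -> (D^-1)%:E * t0 Phi < 1 <-> t0 Phi < D%:E.
Proof.
move=> D0; have t00 : 0 <= t0 Phi by apply: ereal_sup_ubound; right.
case: (t0 Phi) t00 => [r| |]// r0.
  by rewrite -EFinM !lte_fin mulrC ltr_pdivrMr// mul1r.
by rewrite gt0_muley ?lte_fin ?invr_gt0.
Qed.

Lemma cond_dP : cond_d Phi <-> logtail Phi 1 = +oo.
Proof.
split=> [[d [d0 [dt dy]]]|ly].
  move: dt dy; rewrite -(invrK d); have D0 : (0 < d^-1)%R by rewrite invr_gt0.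
  move=> /(mul_t0_lt1 _ D0)/(t0_lt _ nn)[_ PD] /(integral_Hinvr _ D0 PD).
  exact: logtail_indep.
have [D tD] := logtail_t0 _ nd ly; have [D0 PD] := t0_lt _ nn _ tD.
exists D^-1%R; rewrite invr_gt0; split => //; split; first exact/mul_t0_lt1.
by apply/integral_Hinvr => //; apply: logtail_indep ly.
Qed.

(** The dichotomy separates the case in which (a) and (b) hold by convention from the one in which
    the Stieltjes measure of H is defined from every base point beyond [t0]. *)
Lemma eventually_inftyP :
  eventually_infty Phi \/ forall t, (0 <= t)%R -> Phi t < +oo.
Proof.
have [|fin] := pselect (exists2 t : R, (0 <= t)%R & Phi t = +oo); last first.
  right=> t t0; rewrite ltey; apply/eqP => Pt; apply: fin; by exists t.
move=> [t t0 Pt]; left; exists t => s ts; apply/eqP; rewrite -leye_eq -Pt.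
exact: nd.
Qed.

Lemma eventually_infty_logtail : eventually_infty Phi -> logtail Phi 1 = +oo.
Proof.
move=> [T hT]; apply: (@logtail_y _ _ nn nd (Num.max T 0%R)) => //.
  by rewrite le_max lexx orbT.
by rewrite /H hT// le_max lexx.
Qed.

Lemma LSok_fin (D : R) : (forall t, (0 <= t)%R -> Phi t < +oo) ->
  t0 Phi < D%:E -> LSok Phi D.
Proof.
move=> fin /(t0_lt _ nn)[D0 PD]; split => // t Dt.
by apply: fin; rewrite (le_trans (ltW D0)).
Qed.

(** * The Stieltjes measure of H and condition (b) *)

Section stieltjes.
Variables (D : R) (h : LSok Phi D).
Local Notation G := (LS_cum h).
Local Notation mu := (lebesgue_stieltjes_measure (LS_cum h)).

Lemma LS_mu_itvoc (a b : R) : (a <= b)%R -> mu `]a, b]%classic = (G b - G a)%:E.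
Proof.
move=> ab; rewrite /lebesgue_stieltjes_measure/= /measure_extension/= measurable_mu_extE/=; last exact: is_ocitv.
by rewrite wlength_itv_bnd.
Qed.

(** [G] is the right limit of H. Together with [LS_G_le_hr] this sandwiches [G s] between [H s] and
    the values of H to the right of [s], which controls the measure of intervals even where H
    jumps. *)
Lemma LS_hr_le_G (s : R) : (LS_hr Phi D s <= G s)%R.
Proof.
apply: lb_le_inf.
  by exists (LS_hr Phi D (s + 1)), (s + 1)%R => //=; rewrite in_itv/= andbT ltrDl.
move=> _ [u /= + <-]; rewrite in_itv/= andbT => su.
by apply: LS_hr_nd => //; exact: ltW.
Qed.

Lemma LS_G_le_hr (s t : R) : (s < t)%R -> (G s <= LS_hr Phi D t)%R.
Proof.
move=> st; apply: ge_inf; last by exists t => //=; rewrite in_itv/= andbT.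
exists (LS_hr Phi D s) => _ [u /= + <-]; rewrite in_itv/= andbT => su.
by apply: LS_hr_nd => //; exact: ltW.
Qed.

Lemma LS_hrE (s : R) : (D <= s)%R -> LS_hr Phi D s = Hreal Phi s.
Proof. by move=> Ds; rewrite /LS_hr max_l. Qed.

Lemma H_Hreal (s : R) : (D <= s)%R -> H Phi s = (Hreal Phi s)%:E.
Proof.
case: h => mono D0 PD fin Ds.
have Ps : 0 < Phi s by apply: (lt_le_trans PD); apply: mono => //; exact: ltW.
rewrite /H /Hreal -lne_EFin ?fineK ?fine_gt0 ?Ps ?fin//.
by rewrite ge0_fin_numE ?fin// ltW.
Qed.

Lemma LS_hr_le (s : R) : (s <= D)%R -> LS_hr Phi D s = Hreal Phi D.
Proof. by move=> sD; rewrite /LS_hr max_r. Qed.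

Lemma LS_integralP :
  \int[mu]_(t in `[D, +oo[) (t^-1)%:E = +oo <-> logtail Phi 1 = +oo.
Proof.
have [mono D0 PD fin] := h.
have HD : H Phi D <= (G D)%:E.
  by rewrite H_Hreal// lee_fin -LS_hrE// LS_hr_le_G.
have mA : measurable (`[D, +oo[%classic : set (measurableTypeR R)) by exact: measurable_itv.
have mE : measurable_fun (`[D, +oo[%classic : set (measurableTypeR R)) (@EFin R).
  exact/measurable_EFinP.
have pos (x : R) : (`[D, +oo[%classic : set R) x -> 0 < x%:E.
  by rewrite /= in_itv/= andbT lte_fin; exact: lt_le_trans.
have mS (s : R) : measurable ((`[D, +oo[%classic : set (measurableTypeR R)) `&` [set x | x%:E <= s%:E]).
  exact: emeasurable_fun_infty_c.
have mu1 (S : set (measurableTypeR R)) : measurable S -> \int[mu]_(x in S) (cst 1 x) = mu S.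
  by move=> ms; rewrite integral_cst// mul1e.
have -> : \int[mu]_(t in `[D, +oo[) (t^-1)%:E = \int[mu]_(t in `[D, +oo[) (cst 1 t * erecip t%:E).
  by apply: eq_integral => t _; rewrite /= mul1e.
split=> [hy|hy].
- have HD' : H Phi D <= (Hreal Phi D)%:E by rewrite H_Hreal.
  apply: (@excessP _ _ nn nd D (Hreal Phi D) D0 HD').1.
  apply/eqP; rewrite -leye_eq.
  have : \int[mu]_(t in `[D, +oo[) (cst 1 t * erecip t%:E) <= 2%:E * excess Phi (Hreal Phi D).
    apply: (@integral_erecip_le_tail _ (measurableTypeR R) R mu) => //.
    move=> s s0; rewrite mu1//.
    have [sD|Ds] := ltP (s / 2)%R D.
      rewrite (_ : _ `&` _ = set0) ?measure0 ?maxe0_ge0//.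
      apply/seteqP; split => x //= []; rewrite in_itv/= andbT lee_fin => Dx xs.
      by move: sD; rewrite ltNge (le_trans Dx).
    have ss : (s / 2 < s)%R by rewrite ltr_pdivrMr// ltr_pMr// ltr1n.
    (* Any left end below [D] would do: the possible atom of [mu] at [D] has to be included, and
       [G (D - 1) >= H D] because [LS_hr] is constant up to [D]. *)
    apply: (@le_trans _ _ (mu `]D - 1, s / 2]%classic)%R).
      apply: le_measure; rewrite ?inE; [exact: mS|exact: measurable_itv|].
      move=> x /= []; rewrite !in_itv/= andbT lee_fin => Dx ->; rewrite andbT.
      by rewrite (lt_le_trans _ Dx)// ltrBlDr ltrDl.
    have D1 : (D - 1 < D)%R by rewrite ltrBlDr ltrDl.
    rewrite LS_mu_itvoc; last by rewrite (le_trans (ltW D1)).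
    rewrite le_max H_Hreal ?(le_trans Ds) ?(ltW ss)// -EFinD lee_fin lerB//.
      by rewrite -LS_hrE ?(le_trans Ds) ?(ltW ss)// LS_G_le_hr.
    by rewrite -(@LS_hr_le (D - 1)) ?(ltW D1)// LS_hr_le_G.
  rewrite hy; case: (excess _ _) => [r| |]//.
  by rewrite gt0_muleNy ?lte_fin.
(* The lower bound discards the atom at [D], so the base level is now the right limit [G D] instead
   of [H D]. *)
- have {}hy : excess Phi (G D) = +oo by apply/(@excessP _ _ nn nd D).
  apply/eqP; rewrite -leye_eq -hy.
  apply: (@le_tail_integral_erecip _ (measurableTypeR R) R mu _ (cst 1) EFin) => //.
    by move=> s _; rewrite maxe0_ge0.
  move=> s s0; rewrite mu1//.
  have [sD|Ds] := leP s D.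
    rewrite max_r ?measure_ge0// leeBlDr// add0e (le_trans _ HD)//.
    by apply: H_nd => //; exact: ltW.
  rewrite ge_max measure_ge0 andbT.
  apply: (@le_trans _ _ (mu `]D, s]%classic)); last first.
    apply: le_measure; rewrite ?inE; [exact: measurable_itv|exact: mS|].
    by move=> x /=; rewrite !in_itv/= andbT lee_fin => /andP[/ltW -> ->].
  rewrite LS_mu_itvoc ?(ltW Ds)// H_Hreal ?(ltW Ds)// -EFinD lee_fin lerB//.
  by rewrite -LS_hrE ?(ltW Ds)// LS_hr_le_G.
Qed.

End stieltjes.

Lemma LS_integral_eqyP (D : R) : LSok Phi D ->
  LS_integral Phi D = +oo <-> logtail Phi 1 = +oo.
Proof.
by move=> h; rewrite /LS_integral; case: pselect => // h'; exact: LS_integralP.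
Qed.

Lemma cond_bP : cond_b Phi <-> logtail Phi 1 = +oo.
Proof.
split=> [[D [tD [/eventually_infty_logtail//|hy]]]|ly].
  have [/eventually_infty_logtail//|fin] := eventually_inftyP.
  by move: hy; rewrite LS_integral_eqyP//; exact: LSok_fin.
have [D tD] := logtail_t0 _ nd ly; exists D; split => //.
have [EI|fin] := eventually_inftyP; [by left|right].
by apply/LS_integral_eqyP => //; exact: LSok_fin.
Qed.

End conditions_d_b.

(** * From (a) to (b): difference quotients and Fatou *)

Lemma limn_einf_ge0 (R : realType) (u : (\bar R)^nat) :
  (forall n, 0 <= u n) -> 0 <= limn_einf u.
Proof.
move=> u0; rewrite limn_einf_lim; apply: lime_ge; first exact: is_cvg_einfs.
by apply: nearW => n; apply: le_ereal_inf_tmp => _ [m _ <-].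
Qed.

Lemma limn_einf_le (R : realType) (u : (\bar R)^nat) (c : \bar R) :
  (forall n, u n <= c) -> limn_einf u <= c.
Proof.
move=> uc; rewrite limn_einf_lim; apply: lime_le; first exact: is_cvg_einfs.
apply: nearW => n; apply: (le_trans _ (uc n)).
by apply: ereal_inf_lbound; exists n => /=.
Qed.

Lemma derivable_cvg_seq (R : realType) (f : R -> R) (t : R) (e : R^nat) :
  derivable f t 1%R -> (forall n, e n != 0%R) -> e n @[n --> \oo] --> 0%R ->
  ((e n)^-1 * (f (t + e n) - f t))%R @[n --> \oo] --> derive1 f t.
Proof.
move=> dt e0 ecv; rewrite derive1E.
have /cvgr_dnbhsP/(_ e) hh : (h^-1 *: ((f \o shift t) (h *: 1) - f t))%R @[h --> 0%R^'] --> ('D_1 f t)%R.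
  exact: dt.
have eE n : ((e n)^-1 *: ((f \o shift t) (e n *: 1) - f t) =
    (e n)^-1 * (f (t + e n) - f t))%R.
  by congr (_ * (f _ - _))%R; rewrite /= /GRing.scale/= mulr1 addrC.
by under eq_fun do rewrite -eE; exact: hh.
Qed.

Section condition_a.
Context {R : realType}.
Variable Phi : R -> \bar R.
Hypotheses (nn : nonneg0 Phi) (nd : nondecreasing0 Phi).

(* The window around [x] is two-sided because the Stieltjes measure only sees the
   right limits of H: [H(t + e) - H(t)] is bounded by the dH-mass of the interval from [t - e] to [t + e]. *)
Lemma integral_window (D e x : R) : (0 < D)%R -> (0 < e)%R -> (e <= D)%R -> (0 < x)%R ->
  \int[leb]_(t in `[D, +oo[ `&` [set t | (t - e < x)%R /\ (x <= t + e)%R]) (e^-1 * t^-1)%:E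
  <= (4 * x^-1)%:E.
Proof.
move=> D0 e0 eD x0.
have inS : (`[D, +oo[%classic : set (measurableTypeR R)) `&` [set t : R | (t - e < x)%R /\ (x <= t + e)%R]
   `<=` `[(x - e)%R, (x + e)%R]%classic.
  move=> t /= [_ [tx xt]]; rewrite in_itv/=; apply/andP; split; first by rewrite lerBlDr.
  by rewrite -lerBlDr ltW.
have mS : measurable ((`[D, +oo[%classic : set R) `&` [set t : R | (t - e < x)%R /\ (x <= t + e)%R]).
  apply: is_interval_measurable => s t /= [+ [hs1 hs2]] [+ [ht1 ht2]] u /andP[su ut].
  rewrite !in_itv/= !andbT => Ds Dt; split; [|split].
  - exact: le_trans su.
  - by move: ut ht1; lra.
  - by move: su hs2; lra.
(* In the window [x <= t + e <= 2 t], hence [1 / t <= 2 / x]; as the window has length at most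
   [2 e], the constant is 4. *)
apply: (@le_trans _ _ (\int[leb]_(t in `[D, +oo[ `&` [set t | (t - e < x)%R /\ (x <= t + e)%R])
    cst (e^-1 * (2 * x^-1))%:E t)).
  apply: le_lower_integral => t [/=]; rewrite in_itv/= andbT => Dt [tx xt].
    by rewrite lee_fin mulr_ge0// invr_ge0 ltW// (lt_le_trans D0).
  have t0 : (0 < t)%R by exact: lt_le_trans Dt.
  rewrite lee_fin ler_wpM2l ?invr_ge0 ?(ltW e0)// ler_pdivlMr//.
  by rewrite mulrC ler_pdivrMr//; move: xt eD Dt; lra.
apply: (@le_trans _ _ (\int[leb]_(t in `[(x - e)%R, (x + e)%R]) cst (e^-1 * (2 * x^-1))%:E t)).
  apply: ge0_subset_integral => //.
  by move=> t _; rewrite lee_fin !mulr_ge0// invr_ge0 ltW.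
rewrite integral_cst//= lebesgue_measure_itv/= lte_fin.
have -> : (x - e < x + e)%R by move: e0; lra.
rewrite -EFinD -EFinM lee_fin le_eqVlt; apply/orP; left; apply/eqP.
field; rewrite !gt_eqF//.
Qed.

Lemma Hreal_nd (D s t : R) : LSok Phi D -> (D <= s)%R -> (s <= t)%R ->
  (Hreal Phi s <= Hreal Phi t)%R.
Proof.
move=> h Ds st; rewrite -!(LS_hrE Phi D)// ?(le_trans Ds)//.
exact: LS_hr_nd.
Qed.

Lemma Hder_ge0 (D t : R) : LSok Phi D -> (D <= t)%R -> (0 <= Hder Phi t)%R.
Proof.
move=> h Dt; rewrite /Hder; case: asboolP => [dt|//].
have n0 n : (0 < @harmonic R n)%R by rewrite /= invr_gt0 ltr0n.
have cf : ((harmonic n)^-1 * (Hreal Phi (t + harmonic n) - Hreal Phi t))%R @[n --> \oo]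
    --> derive1 (Hreal Phi) t.
  by apply: derivable_cvg_seq => // [n|]; [rewrite gt_eqF|exact: cvg_harmonic].
rewrite -(cvg_lim _ cf)//; apply: limr_ge; first by apply/cvg_ex; eexists; exact: cf.
apply: nearW => n; rewrite mulr_ge0 ?invr_ge0 ?(ltW (n0 n))// subr_ge0.
by apply: (Hreal_nd D) => //; rewrite lerDl ltW.
Qed.

Lemma cond_a_b : cond_a Phi -> cond_b Phi.
Proof.
move=> [D [tD [EI|hy]]]; first by exists D; split => //; left.
have [EI|fin] := eventually_inftyP _ nd; first by exists D; split => //; left.
(* The windows around points [t >= D] reach to the left of [D]. The Stieltjes measure is therefore
   based at a smaller admissible [D1], and the steps [e n] are at most [D - D1]. *)
have [D1 tD1 D1D] : exists2 D1 : R, t0 Phi < D1%:E & (D1 < D)%R.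
  have t00 : 0 <= t0 Phi by apply: ereal_sup_ubound; right.
  move: t00 tD; case: (t0 Phi) => [r| |]//; rewrite lte_fin => _ rD.
  by exists ((r + D) / 2)%R; rewrite ?lte_fin; move: rD; lra.
have h := @LSok_fin _ Phi nn nd D1 fin tD1.
have [_ D10 PD1 _] := h.
apply/cond_bP => //; apply/(@LS_integralP _ Phi nn nd D1 h).
set mu := lebesgue_stieltjes_measure (LS_cum h).
have D0 : (0 < D)%R by exact: lt_trans D1D.
pose e n : R := ((D - D1) * harmonic n)%R.
have e0 n : (0 < e n)%R by rewrite mulr_gt0 ?subr_gt0//= invr_gt0 ltr0n.
have eD n : (e n <= D - D1)%R.
  by rewrite /e ler_piMr ?subr_ge0 ?(ltW D1D)//= invf_le1 ?ltr0n// ler1n.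
pose f n t : \bar R := ((e n)^-1 * t^-1)%:E * ((Hreal Phi (t + e n)) - Hreal Phi t)%:E.
have HrG (s t : R) := @Hreal_nd D1 s t h.
have f0 n t : `[D, +oo[%classic t -> 0 <= f n t.
  rewrite /= in_itv/= andbT => Dt; rewrite mule_ge0// lee_fin.
    by rewrite mulr_ge0// invr_ge0 ltW// (lt_le_trans D0).
  by rewrite subr_ge0 HrG// ?lerDl ?ltW// (lt_le_trans D1D).
have mf n : measurable_fun (`[D, +oo[%classic : set R) (f n).
  apply: emeasurable_funM; apply/measurable_EFinP.
    by apply: measurable_funM => //; exact: measurable_invr.
  apply: measurable_funB.
    apply/measurable_EFinP; apply: emeasurable_fun_nd; first exact: interval_is_interval.
    move=> s t /=; rewrite !in_itv/= !andbT => Ds _ st; rewrite lee_fin HrG ?lerD2r//.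
    by rewrite (le_trans (ltW D1D))// (le_trans Ds)// lerDl ltW.
  apply/measurable_EFinP; apply: emeasurable_fun_nd; first exact: interval_is_interval.
  move=> s t /=; rewrite !in_itv/= !andbT => Ds _ st; rewrite lee_fin HrG//.
  by rewrite (le_trans (ltW D1D)).
have cvf t : `[D, +oo[%classic t -> derivable (Hreal Phi) t 1%R ->
    f n t @[n --> \oo] --> (derive1 (Hreal Phi) t / t)%:E.
  move=> Dt dt.
  have -> : f ^~ t = EFin \o (fun n => ((e n)^-1 * (Hreal Phi (t + e n) - Hreal Phi t) * t^-1)%R).
    by apply/funext => n; rewrite /f /= -EFinM mulrAC.
  apply: cvg_EFin; first exact: nearW.
  apply: cvgMl; apply: derivable_cvg_seq => // [n|]; first by rewrite gt_eqF.
  rewrite -[X in _ --> X](mulr0 (D - D1)%R); apply: cvgMr; exact: cvg_harmonic.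
(* Where H is not derivable, [Hder] is 0 by definition, and nonnegativity of the quotients
   suffices. *)
have Hle t : `[D, +oo[%classic t -> (Hder Phi t / t)%:E <= limn_einf (f ^~ t).
  move=> Dt; rewrite /Hder; case: asboolP => [dt|_].
    by have /cvg_limn_einf_sup[-> _] := cvf _ Dt dt.
  by rewrite mul0r; apply: limn_einf_ge0 => n; exact: f0.
have H0 t : `[D, +oo[%classic t -> 0 <= (Hder Phi t / t)%:E.
  rewrite /= in_itv/= andbT => Dt; rewrite lee_fin; apply: divr_ge0; last by rewrite (le_trans (ltW D0)).
  by apply: (Hder_ge0 D1) => //; rewrite (le_trans (ltW D1D)).
have fle n : \int[leb]_(t in `[D, +oo[) f n t <= 4%:E * \int[mu]_(t in `[D1, +oo[) (t^-1)%:E.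
  pose E : set (measurableTypeR R * measurableTypeR R) :=
    [set z | (z.1 - e n)%:E < z.2%:E] `&` [set z | z.2%:E <= (z.1 + e n)%:E].
  have mE : measurable E.
    apply: measurableI.
      rewrite -[X in measurable X]setTI; apply: measurable_lte => //; apply/measurable_EFinP => //.
      exact: measurable_funB.
    rewrite -[X in measurable X]setTI; apply: measurable_lee => //; apply/measurable_EFinP => //.
    exact: measurable_funD.
  have mw : measurable_fun (`[D, +oo[%classic : set (measurableTypeR R)) (fun t : R => ((e n)^-1 * t^-1)%:E).
    apply/measurable_EFinP; apply: measurable_funM => //; exact: measurable_invr.
  have w0 (t : R) : `[D, +oo[%classic t -> 0 <= ((e n)^-1 * t^-1)%:E.
    rewrite /= in_itv/= andbT => Dt.
    by rewrite lee_fin mulr_ge0// invr_ge0 ltW// (lt_le_trans D0).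
  have T := @tonelli_relation _ _ (measurableTypeR R) (measurableTypeR R) R leb mu
    `[D, +oo[%classic `[D1, +oo[%classic (fun t : R => ((e n)^-1 * t^-1)%:E) (cst 1) E
    (measurable_itv _) (measurable_itv _) mE mw (measurable_cst _) w0 (fun=> fun=> lee01).
  apply: (@le_trans _ _ (\int[leb]_(x in `[D, +oo[) (((e n)^-1 * x^-1)%:E *
      \int[mu]_(y in `[D1, +oo[ `&` [set y | E (x, y)]) cst 1 y))).
    apply: le_lower_integral => t Dt; first exact: f0.
    rewrite /f lee_wpmul2l ?w0//.
    move: (Dt); rewrite /= in_itv/= andbT => Dt'.
    have en := e0 n; have eDn := eD n.
    (* The slice is half-open, so its [mu]-mass is [G (t + e n) - G (t - e n)], which dominates
       [H (t + e n) - H t] by the sandwich for [G]. *)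
    have -> : `[D1, +oo[ `&` [set y | E (t, y)] = `](t - e n)%R, (t + e n)%R]%classic.
      apply/seteqP; split => y; rewrite /E/= !in_itv/= ?andbT !lte_fin ?lee_fin.
        by move=> [_ [-> ->]].
      by move=> /andP[y1 y2]; split => //; move: eDn y1 Dt'; lra.
    rewrite integral_cst ?mul1e; last exact: measurable_itv.
    have tee : (t - e n <= t + e n)%R by move: en; lra.
    have /esym M := @LS_mu_itvoc R Phi D1 h (t - e n)%R (t + e n)%R tee.
    apply: (@le_trans _ _ (LS_cum h (t + e n) - LS_cum h (t - e n))%R%:E); last by rewrite M.
    rewrite lee_fin lerB//.
      rewrite -(LS_hrE Phi D1); last by move: en Dt' D1D; lra.
      exact: LS_hr_le_G.
    rewrite -(LS_hrE Phi D1); last by move: Dt' D1D; lra.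
    by apply: LS_G_le_hr; move: en; lra.
  rewrite T; clear T.
  rewrite -ge0_integralZl//; last 2 first.
    by apply/measurable_EFinP; exact: measurable_invr.
    by move=> x; rewrite /= in_itv/= andbT => D1x; rewrite lee_fin invr_ge0 (le_trans (ltW D10)).
  apply: le_lower_integral => x; rewrite /= in_itv/= andbT => D1x.
    rewrite mul1e; apply: integral_ge0 => t [Dt _]; exact: w0.
  rewrite mul1e -EFinM; apply: (le_trans _ (@integral_window D (e n) x _ _ _ _)) => //.
  - by move: (eD n) D10; lra.
  - exact: lt_le_trans D1x.
have : \int[leb]_(t in `[D, +oo[) (Hder Phi t / t)%:E <= 4%:E * \int[mu]_(t in `[D1, +oo[) (t^-1)%:E.
  apply: (@le_trans _ _ (\int[leb]_(t in `[D, +oo[) limn_einf (f ^~ t))).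
    exact: le_lower_integral.
  apply: (@le_trans _ _ (limn_einf (fun n => \int[leb]_(t in `[D, +oo[) f n t))).
    by apply: fatou.
  exact: limn_einf_le.
rewrite hy; case: (\int[mu]_(t in _) _) => [r| |]//.
by rewrite gt0_muleNy ?lte_fin.
Qed.

End condition_a.

(** * Absolute continuity of H and of its Stieltjes measure *)

Lemma grid_cell (R : realType) (D w x : R) (N : nat) :
  (D < x)%R -> (x <= D + N%:R * w)%R ->
  exists2 i, (i < N)%N & (D + i%:R * w < x /\ x <= D + i.+1%:R * w)%R.
Proof.
move=> Dx; elim: N => [|N ih] xN.
  by move: Dx; rewrite ltNge; move: xN; rewrite mul0r addr0 => ->.
have [/ih[i iN ?]|Nx] := leP x (D + N%:R * w)%R; last by exists N.
by exists i => //; exact: leq_trans iN _.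
Qed.

Section absolute_continuity.
Context {R : realType}.
Variable Phi : R -> \bar R.
Hypotheses (nn : nonneg0 Phi) (nd : nondecreasing0 Phi).
Variables (D : R) (h : LSok Phi D).
Local Notation G := (LS_cum h).
Local Notation mu := (lebesgue_stieltjes_measure (LS_cum h)).

(** Apply [ln (1 + x) <= x] to the relative increment of [Phi], whose denominator [Phi s] is at
    least [Phi D]. Hence absolute continuity passes from [Phi] to H from [D] on. *)
Lemma Hreal_lipschitz (s t : R) : (D <= s)%R -> (s <= t)%R ->
  (Hreal Phi t - Hreal Phi s <= (fine (Phi D))^-1 * (fine (Phi t) - fine (Phi s)))%R.
Proof.
have [_ D0 PD fin] := h.
have ff x : (D <= x)%R -> Phi x \is a fin_num.
  by move=> Dx; rewrite ge0_fin_numE ?fin// nn// (le_trans (ltW D0)).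
have fle x y : (D <= x)%R -> (x <= y)%R -> (fine (Phi x) <= fine (Phi y))%R.
  move=> Dx xy; apply: fine_le; rewrite ?ff ?(le_trans Dx)//.
  by apply: nd => //; rewrite (le_trans (ltW D0)).
have pD : (0 < fine (Phi D))%R by rewrite fine_gt0// PD fin.
move=> Ds st; have ps : (0 < fine (Phi s))%R by rewrite (lt_le_trans pD)// fle.
have pt : (0 < fine (Phi t))%R by rewrite (lt_le_trans ps)// fle.
rewrite /Hreal -ln_div ?posrE//.
have -> : (fine (Phi t) / fine (Phi s) = 1 + (fine (Phi t) - fine (Phi s)) / fine (Phi s))%R.
  by field; rewrite gt_eqF.
apply: (@le_trans _ _ ((fine (Phi t) - fine (Phi s)) / fine (Phi s))%R).
  apply: le_ln1Dx; rewrite (lt_le_trans (ltrN10 _))// divr_ge0 ?(ltW ps)//.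
  by rewrite subr_ge0 fle.
by rewrite mulrC ler_wpM2r ?subr_ge0 ?fle// lef_pV2 ?posrE// fle.
Qed.

Lemma Hreal_abs_cont (M : R) : abs_cont_on 0 M (fun t => fine (Phi t)) ->
  abs_cont_on D M (Hreal Phi).
Proof.
have [_ D0 PD fin] := h.
have pD : (0 < fine (Phi D))%R by rewrite fine_gt0// PD fin//.
move=> ac e e0; have [d d0 hd] := ac (e * fine (Phi D))%R (mulr_gt0 e0 pD).
exists d => // n u v uv dis sd.
apply: (@le_lt_trans _ _ (\sum_(k < n) (fine (Phi D))^-1 * `|fine (Phi (v k)) - fine (Phi (u k))|)%R).
  apply: ler_sum => k _; have [Du [uvk _]] := uv k (ltn_ord k).
  rewrite ger0_norm ?subr_ge0 ?(Hreal_nd _ D)//.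
  apply: (le_trans (Hreal_lipschitz _ _ Du uvk)).
  by rewrite ler_wpM2l ?invr_ge0 ?(ltW pD)// ler_norm.
rewrite (_ : (\sum_(k < n) _)%R = ((fine (Phi D))^-1 *
    \sum_(k < n) `|fine (Phi (v k)) - fine (Phi (u k))|)%R); last by rewrite mulr_sumr.
rewrite mulrC ltr_pdivrMr//; apply: hd => // k kn.
have [Du [uvk vM]] := uv k kn; split => //.
by rewrite (le_trans (ltW D0)).
Qed.

Hypothesis ac : forall M, (D < M)%R -> abs_cont_on D M (Hreal Phi).

(** Absolute continuity for the single interval [[s, s + r]] gives right continuity, so the
    regularization changes nothing. *)
Lemma LS_cum_Hreal (s : R) : (D <= s)%R -> G s = Hreal Phi s.
Proof.
move=> Ds; apply/eqP; rewrite eq_le; apply/andP; split; last first.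
  by rewrite -(LS_hrE Phi D)// LS_hr_le_G.
apply/ler_addgt0Pr => e e0.
have sM : (D < s + 1)%R by rewrite (le_lt_trans Ds)// ltrDl.
have [d d0 hd] := ac _ sM e e0.
(* The bound [d / 2] keeps the length below [d], and the bound 1 keeps the interval inside
   [[D, s + 1]]. *)
pose r : R := Num.min (d / 2)%R 1%R.
have r0 : (0 < r)%R by rewrite lt_min divr_gt0 ?ltr01.
have rd : (r < d)%R.
  by rewrite gt_min ltr_pdivrMr// ltr_pMr// ltr1n.
have r1 : (r <= 1)%R by rewrite ge_min lexx orbT.
apply: (@le_trans _ _ (Hreal Phi (s + r))).
  rewrite -(LS_hrE Phi D); last by rewrite (le_trans Ds)// lerDl ltW.
  by apply: LS_G_le_hr; rewrite ltrDl.
have := hd 1%N (fun=> s) (fun=> s + r)%R.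
rewrite !big_ord1 /= (_ : (s + r - s)%R = r); last by rewrite addrC addKr.
move=> H; rewrite -lerBlDl.
apply: (le_trans (ler_norm _)); apply/ltW; apply: H => //.
- by move=> k _; rewrite lerDl lerD2l; split => //; split => //; exact: ltW.
- by move=> [|i] [|j].
Qed.

Lemma mu_itvoc_Hreal (a b : R) : (D <= a)%R -> (a <= b)%R ->
  mu `]a, b]%classic = (Hreal Phi b - Hreal Phi a)%:E.
Proof. by move=> Da ab; rewrite LS_mu_itvoc// !LS_cum_Hreal// (le_trans Da). Qed.

(** Outer regularity encloses the null set in an open set [U] of length below the modulus [d]
    belonging to [e]; absolute continuity then bounds the [mu]-mass by [e]. *)
Lemma mu_null (M : R) (A : set R) : (D < M)%R -> measurable A ->
  leb A = 0 -> mu (A `&` `]D, M]%classic) = 0.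
Proof.
move=> DM mA A0; apply/eqP; rewrite eq_le measure_ge0 andbT.
apply/lee_addgt0Pr => e e0; rewrite add0e.
have [d d0 hd] := ac _ DM e e0.
have lA : leb A < +oo by rewrite A0 ltry.
have [U [oU AU UA]] : exists U : set R, [/\ open U, A `<=` U & leb (U `\` A) < d%:E].
  by apply: lebesgue_regularity_outer => //; exact: lA.
have mU : measurable U by exact: open_measurable.
have Ud : leb U < d%:E.
  rewrite -(setDUK AU); apply: le_lt_trans UA.
  have UA2 : leb (A `|` (U `\` A)) <= leb A + leb (U `\` A).
    by apply: measureU2; [exact: mA|exact: measurableD].
  by move: UA2; rewrite A0 add0e.
(* [V n] is the union of the cells of an n-point grid that lie inside [U]; these unions
   exhaust [U], and absolute continuity applies to each of them. *)
pose w n : R := ((M - D) / n.+1%:R)%R.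
have w0 n : (0 < w n)%R by rewrite divr_gt0 ?subr_gt0 ?ltr0n.
pose c n k : R := (D + k%:R * w n)%R.
have cS n k : (c n k <= c n k.+1)%R.
  by rewrite lerD2l ler_pM2r// ler_nat.
have cle n i j : (i <= j)%N -> (c n i <= c n j)%R.
  by move=> ij; rewrite lerD2l ler_pM2r// ler_nat.
have cN n : c n n.+1 = M by rewrite /c /w mulrC divfK ?pnatr_eq0// addrC subrK.
have Dc n k : (D <= c n k)%R by rewrite lerDl mulr_ge0// ltW.
(* A cell not contained in [U] is collapsed to an empty interval. All indices below [n + 1] are thus
   kept, which fits the finite families in the definition of absolute continuity. *)
pose v n k := if `[< `]c n k, c n k.+1]%classic `<=` U >] then c n k.+1 else c n k.
have cv n k : (c n k <= v n k)%R by rewrite /v; case: ifP.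
have vc n k : (v n k <= c n k.+1)%R by rewrite /v; case: ifP.
pose cell n k : set R := `](c n k), (v n k)]%classic.
pose V n := \big[setU/set0]_(k < n.+1) cell n k.
have mcell n k : measurable (cell n k : set (measurableTypeR R)).
  exact: measurable_itv.
have mV n : measurable (V n : set (measurableTypeR R)).
  by apply: bigsetU_measurable => k _; exact: mcell.
have VU n : V n `<=` U.
  rewrite /V -(bigcup_mkord _ (cell _)) => x [k _]; rewrite /cell /v; case: asboolP => [cU|_]; first exact: cU.
  by rewrite /= in_itv/= => /andP[/lt_le_trans h1 /h1]; rewrite ltxx.
have lebcell n k : leb (cell n k) = (v n k - c n k)%:E.
  rewrite /cell lebesgue_measure_itv/= lte_fin; case: ltP => // vck.
  have -> : v n k = c n k by apply/eqP; rewrite eq_le vck cv.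
  by rewrite subrr.
have lebV n : leb (V n) = (\sum_(k < n.+1) (v n k - c n k))%R%:E.
  rewrite /V (@measure_semi_additive_ord _ (measurableTypeR R) R leb)//; last 2 first.
  - apply/trivIsetP => i j _ _ ij; apply/seteqP; split => // x []; rewrite /cell /= !in_itv/=.
    move=> /andP[ci vi] /andP[cj vj].
    move: ij; rewrite neq_ltn => /orP[] ij.
    + by have := le_lt_trans (le_trans vi (le_trans (vc n i) (cle n _ _ ij))) cj; rewrite ltxx.
    + by have := le_lt_trans (le_trans vj (le_trans (vc n j) (cle n _ _ ij))) ci; rewrite ltxx.
  - exact: mV.
  by rewrite -sumEFin; apply: eq_bigr => k _; exact: lebcell.
have Ve n : mu (V n) <= e%:E.
  apply: (le_trans (@Boole_inequality _ R (measurableTypeR R) mu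
    (cell n) n.+1 _)); first by move=> *; exact: mcell.
  have cE k : mu (cell n k) = (Hreal Phi (v n k) - Hreal Phi (c n k))%:E.
    exact: mu_itvoc_Hreal.
  apply: (@le_trans _ _ (\sum_(k < n.+1) (Hreal Phi (v n k) - Hreal Phi (c n k))%:E)).
    by apply: lee_sum => k _; rewrite -cE.
  rewrite sumEFin lee_fin; apply: ltW.
  apply: (@le_lt_trans _ _ (\sum_(k < n.+1) `|Hreal Phi (v n k) - Hreal Phi (c n k)|)%R).
    by apply: ler_sum => k _; exact: ler_norm.
  apply: hd.
  - move=> k kn; split; [exact: Dc|split; [exact: cv|]].
    by rewrite (le_trans (vc _ _))// -(cN n) cle.
  - by move=> i j ij _; left; rewrite (le_trans (vc _ _))// cle.
  - rewrite -lte_fin -lebV; apply: le_lt_trans Ud.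
    by apply: le_measure; rewrite ?inE.
(* The grids are not nested and [V] need not be monotone. The sets [W n] increase, so continuity
   from below applies to them. *)
pose W n := \bigcap_m V (n + m)%N.
have mW n : measurable (W n : set (measurableTypeR R)).
  by apply: bigcapT_measurable => m; exact: mV.
have ndW : {homo W : n m / (n <= m)%N >-> (n <= m)%O}.
  move=> n m nm; apply/subsetPset => x Wx k _.
  by have := Wx (m - n + k)%N I; rewrite addnA subnKC.
have mUW : measurable (\bigcup_n W n : set (measurableTypeR R)).
  exact: bigcup_measurable.
have cvW := @nondecreasing_cvg_mu _ (measurableTypeR R) R mu W mW mUW ndW.
apply: (@le_trans _ _ (mu (\bigcup_n W n))); last first.
  rewrite -(cvg_lim _ cvW)//; apply: lime_le; first by apply/cvg_ex; eexists; exact: cvW.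
  apply: nearW => n; apply: (le_trans _ (Ve n)).
  apply: le_measure; rewrite ?inE; [exact: mW|exact: mV|].
  by move=> x /(_ 0%N I); rewrite addn0.
apply: le_measure; rewrite ?inE.
- by apply: measurableI; [exact: mA|exact: measurable_itv].
- exact: mUW.
move=> x [/AU Ux]; rewrite /= in_itv/= => /andP[Dx xM].
have /nbhs_ballP[r /= r0 rU] : nbhs x U by exact: open_nbhs_nbhs.
(* Once the mesh is below [r], the cell containing [x] lies in the ball around [x], hence in [U].
   This holds for all later grids, which places [x] in [W n]. *)
have [n _ wr] : \forall n \near \oo, (w n < r)%R.
  have : w n @[n --> \oo] --> 0%R.
    rewrite -[X in _ --> X](mulr0 (M - D)%R); apply: cvgMr; exact: cvg_harmonic.
  by move=> /cvgr_lt/(_ r r0).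
exists n => // m _; rewrite /V -(bigcup_mkord _ (cell _)).
have {}wr : (w (n + m)%N < r)%R by apply: wr; rewrite /= leq_addr.
have [|k kn [ck kc]] := @grid_cell R D (w (n + m)%N) x (n + m).+1 Dx.
  by have := cN (n + m)%N; rewrite /c => ->.
exists k => //=; rewrite /cell/= in_itv/= ck/= /v ifT//; apply/asboolP => y /=.
rewrite in_itv/= => /andP[cy yc]; apply: rU; rewrite /ball/= ltr_norml.
have cc : (c (n + m)%N k.+1 = c (n + m)%N k + w (n + m)%N)%R.
  by rewrite /c mulrSr mulrDl mul1r addrA.
move: ck kc cy yc wr; rewrite -/(c _ _) -/(c _ _) cc => *.
by apply/andP; split; lra.
Qed.

End absolute_continuity.

(** * The density of dH and the passage from (b) to (a) *)

Section density.
Context {R : realType}.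
Variable Phi : R -> \bar R.
Variables (D : R) (h : LSok Phi D).
Local Notation G := (LS_cum h).
Local Notation mu := (lebesgue_stieltjes_measure (LS_cum h)).
Hypothesis ac : forall M, (D < M)%R -> abs_cont_on D M (Hreal Phi).

(* Radon-Nikodym on the interval from [D] to [M] and Lebesgue's differentiation theorem for the density. *)
Lemma Hreal_density (M : R) : (D < M)%R ->
  exists (g : R -> \bar R) (N : set R),
  [/\ measurable_fun setT g, forall x, 0 <= g x, measurable N, leb N = 0 &
    (forall x, (D < x < M)%R -> ~ N x -> g x = (Hder Phi x)%:E) /\
    \int[mu]_(x in `]D, M[) (x^-1)%:E = \int[leb]_(x in `]D, M[) ((x^-1)%:E * g x)].
Proof.
move=> DM.
have [_ D0 _ _] := h.
have mJ : measurable (`]D, M]%classic : set (measurableTypeR R)) by exact: measurable_itv.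
have muJ : mu `]D, M]%classic < +oo by rewrite LS_mu_itvoc ?ltry// ltW.
(* Restriction to []D, M]] makes the measure finite, so that its Radon-Nikodym density is integrable
   on the whole line. *)
pose nu : {finite_measure set (measurableTypeR R) -> \bar R} := mfrestr mJ muJ.
have nuE A : nu A = mu (A `&` `]D, M]%classic) by [].
have dom : nu `<< leb.
  apply/null_content_dominatesP => A mA A0; rewrite nuE.
  exact: (@mu_null _ _ D h ac M A DM mA A0).
pose g := @Radon_Nikodym_SigmaFinite.f _ (measurableTypeR R) R nu leb.
have g0 : forall x, 0 <= g x := Radon_Nikodym_SigmaFinite.f_ge0 dom.
have gf : forall x, g x \is a fin_num := Radon_Nikodym_SigmaFinite.f_fin_num dom.
have gi : leb.-integrable setT g := Radon_Nikodym_SigmaFinite.f_integrable dom.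
have gE A : measurable A -> nu A = \int[leb]_(x in A) g x :=
  @Radon_Nikodym_SigmaFinite.f_integral _ _ _ _ _ dom A.
have mg : measurable_fun setT g by exact: measurable_int gi.
pose f x := fine (g x).
have fg : EFin \o f = g by apply/funext => x; rewrite /= fineK.
have fi (S : set R) : measurable S -> leb.-integrable S (EFin \o f).
  by move=> mS; rewrite fg; apply: integrableS gi.
have FTC := @FTC1 R f (BRight D) (fun y => fi _ (measurable_itv _))
  (open_integrable_locally openT (fi _ measurableT)).
have [N [mN N0 NP]] := FTC.
exists g, N; split; [exact: mg|exact: g0|exact: mN|exact: N0|split].
- move=> x /andP[Dx xM] Nx.
  pose F (y : R) : R := (\int[leb]_(t in `]D, y]) f t)%R.
  have [dF F'] : derivable F x 1%R /\ derive1 F x = f x.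
    by apply: (contrapT (fun H => Nx (NP x H))); rewrite /= ?lte_fin ?bnd_simp.
  (* The indefinite integral of the density differs from H by a constant near [x], so derivability
     and the derivative carry over to H. *)
  have FE : {near x, (fun y => F y + Hreal Phi D)%R =1 Hreal Phi}.
    near=> y.
    have Dy : (D < y)%R by near: y; exact: lt_nbhsr.
    have yM : (y < M)%R by near: y; exact: lt_nbhsl.
    rewrite /F /Rintegral.
    have -> : \int[leb]_(t in `]D, y]) (f t)%:E = (Hreal Phi y - Hreal Phi D)%:E.
      transitivity (\int[leb]_(t in `]D, y]) g t).
        by apply: eq_integral => t _; rewrite /f fineK.
      rewrite -gE; last exact: measurable_itv.
      rewrite nuE -(@mu_itvoc_Hreal _ _ _ h ac)//; last exact: ltW.
      congr (mu _); apply/seteqP; split => t; rewrite /= !in_itv/=; first by case.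
      by move=> /andP[-> ty]; rewrite ty/= (le_trans ty)// ltW.
    by rewrite /= subrK.
  have dF' : derivable (fun y => F y + Hreal Phi D)%R x 1%R.
    by apply: derivableD; [exact: dF|exact: derivable_cst].
  have dH : derivable (Hreal Phi) x 1%R := near_eq_derivable FE dF'.
  rewrite /Hder; case: asboolP => // _.
  have dc : derivable (fun=> Hreal Phi D) x 1%R by exact: derivable_cst.
  rewrite derive1E -(near_eq_derive _ FE) (deriveD dF dc) derive_cst addr0 -derive1E.
  by rewrite F' /f fineK.
(* The absolute value makes the integrand nonnegative on the whole line, as the change of variables
   asks; on []D, M[] it changes nothing. *)
- have -> : \int[mu]_(x in `]D, M[) (x^-1)%:E = \int[nu]_(x in `]D, M[) (`|x|^-1)%:E.
    transitivity (\int[nu]_(x in `]D, M[) (x^-1)%:E).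
      apply: eq_measure_integral => A mA AJ.
      suff nA : nu A = mu A by exact: (esym nA).
      rewrite nuE setIidl// => x /AJ.
      by rewrite /= !in_itv/= => /andP[-> /ltW].
    apply: eq_integral => x; rewrite inE/= in_itv/= => /andP[Dx _].
    by rewrite ger0_norm// ltW// (lt_trans D0).
  rewrite -(@Radon_Nikodym_SigmaFinite.change_of_variables _ (measurableTypeR R) R nu leb dom
    (fun x : R => (`|x|^-1)%:E)).
  + apply: eq_integral => x; rewrite inE/= in_itv/= => /andP[Dx _].
    by rewrite ger0_norm// ltW// (lt_trans D0).
  + by move=> x; rewrite lee_fin invr_ge0.
  + exact: measurable_itv.
  + apply/measurable_EFinP.
    apply: (@measurableT_comp _ _ _ _ _ _ (fun x : R => x^-1)%R); first exact: measurable_invr.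
    exact: normr_measurable.
Unshelve. all: by end_near. Qed.

(** On bounded intervals the exceptional null set is removed from the integral of the measurable
    density, which equals [Hder] on the rest; monotonicity of lower integrals then reaches [Hder].
    Bounded intervals exhaust the half-line by monotone convergence. *)
Lemma LS_le_integral_Hder :
  \int[mu]_(x in `]D, +oo[) (x^-1)%:E <= \int[leb]_(t in `[D, +oo[) (Hder Phi t / t)%:E.
Proof.
have [_ D0 _ _] := h.
have pos (M t : R) : (D < t < M)%R -> (0 < t)%R by move=> /andP[Dt _]; exact: lt_trans Dt.
have le (M : R) : (D < M)%R ->
    \int[mu]_(x in `]D, M[) (x^-1)%:E <= \int[leb]_(t in `[D, +oo[) (Hder Phi t / t)%:E.
  move=> DM; have [g [N [mg g0 mN N0 [gH ->]]]] := Hreal_density _ DM.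
  have m1 : measurable_fun (`]D, M[%classic : set R) (fun x => (x^-1)%:E * g x).
    apply: emeasurable_funM; last exact: measurable_funTS.
    apply/measurable_EFinP; exact: measurable_invr.
  have p1 x : `]D, M[%classic x -> 0 <= (x^-1)%:E * g x.
    by rewrite /= in_itv/= => /pos x0; rewrite mule_ge0// lee_fin invr_ge0 ltW.
  rewrite (@ge0_negligible_integral _ (measurableTypeR R) R leb _ _ _ mN (measurable_itv _) m1 p1 N0).
  apply: le_subset_lower_integral.
  - by move=> x [] /=; rewrite !in_itv/= andbT => /andP[/ltW].
  - by move=> x [] /p1.
  - move=> x []; rewrite /= in_itv/= => xDM Nx.
    by rewrite gH// -EFinM mulrC.
  - move=> x; rewrite /= in_itv/= andbT => Dx.
    rewrite lee_fin; apply: divr_ge0; last exact: le_trans (ltW D0) Dx.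
    exact: (Hder_ge0 _ D _ h Dx).
pose F n : set (measurableTypeR R) := `]D, (D + n.+1%:R)%R[%classic.
have -> : `]D, +oo[%classic = \bigcup_n F n.
  apply/seteqP; split => x /=; rewrite in_itv/= ?andbT.
    move=> Dx; exists (Num.bound (x - D)) => //; rewrite /F/= in_itv/= Dx/=.
    have xD0 : (0 <= x - D)%R by rewrite subr_ge0 ltW.
    by rewrite -ltrBlDl (lt_trans (archi_boundP xD0))// ltr_nat.
  by move=> [n _]; rewrite /F/= in_itv/= => /andP[].
have mF n : measurable (F n) by exact: measurable_itv.
have mf : forall n, measurable_fun (F n) (fun x : R => (x^-1)%:E).
  by move=> n; apply/measurable_EFinP; apply: (measurable_funS measurableT) => //; exact: measurable_invr.
have f0 n x : F n x -> 0 <= (x^-1 : R)%:E.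
  by rewrite /F/= in_itv/= => /pos x0; rewrite lee_fin invr_ge0 ltW.
have ndF : nondecreasing_seq F.
  move=> n m nm; apply/subsetPset => x; rewrite /F/= !in_itv/= => /andP[-> xn].
  by rewrite (lt_le_trans xn)// lerD2l ler_nat.
have cv := @ge0_nondecreasing_set_cvg_integral _ (measurableTypeR R) R F _ mu ndF mF mf f0.
rewrite -(cvg_lim _ cv)//; apply: lime_le; first by apply/cvg_ex; eexists; exact: cv.
by apply: nearW => n; apply: le; rewrite ltrDl.
Qed.

(** Only the end point [D] separates this from the preceding bound, and a single point has finite
    [mu]-mass. *)
Lemma LS_integral_Hder : \int[mu]_(x in `[D, +oo[) (x^-1)%:E = +oo ->
  \int[leb]_(t in `[D, +oo[) (Hder Phi t / t)%:E = +oo.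
Proof.
have [_ D0 _ _] := h.
move=> hy; apply/eqP; rewrite -leye_eq; apply: le_trans LS_le_integral_Hder.
rewrite leye_eq; apply/eqP.
have m1 (S : set R) : measurable S -> measurable_fun S (fun x : R => (x^-1)%:E).
  by move=> mS; apply/measurable_EFinP; exact: measurable_invr.
move: hy; rewrite (@itv_bndbnd_setU _ _ (BLeft D) (BRight D) +oo%O) ?bnd_simp//.
rewrite set_itv1 ge0_integral_setU; last 5 first.
- exact: measurable_set1.
- exact: measurable_itv.
- by apply: m1; apply: measurableU; [exact: measurable_set1|exact: measurable_itv].
- move=> x [->|/=]; first by rewrite lee_fin invr_ge0 ltW.
  by rewrite in_itv/= andbT => Dx; rewrite lee_fin invr_ge0 ltW// (lt_trans D0).
- by apply/disj_setPS => x [-> /=]; rewrite in_itv/= ltxx.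
apply: ltey_adde_eqy.
rewrite (eq_integral (cst (D^-1)%:E)); last by move=> x /set_mem ->.
rewrite integral_cst; last exact: measurable_set1.
rewrite lte_mul_pinfty ?lee_fin ?invr_ge0 ?(ltW D0)//.
have D1 : (D - 1 <= D)%R by rewrite lerBlDr lerDl.
apply: (@le_lt_trans _ _ (mu `](D - 1)%R, D]%classic)).
  apply: le_measure; rewrite ?inE; [exact: measurable_set1|exact: measurable_itv|].
  by move=> x -> /=; rewrite in_itv/= lexx andbT ltrBlDr ltrDl.
by rewrite LS_mu_itvoc// ltry.
Qed.

End density.

Lemma cond_b_a (R : realType) (Phi : R -> \bar R) : nonneg0 Phi -> nondecreasing0 Phi ->
  abs_cont0 Phi -> cond_b Phi -> cond_a Phi.
Proof.
move=> nn nd [fin ac] [D [tD b]]; exists D; split => //.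
case: b => [EI|hy]; [by left|right].
have h : LSok Phi D by exact: LSok_fin.
move: hy; rewrite /LS_integral; case: pselect => // h'.
have [_ D0 _ _] := h.
apply: LS_integral_Hder => // M DM; apply: Hreal_abs_cont => //; apply: ac.
exact: lt_trans DM.
Qed.

(** * Convex functions, and the collected equivalences *)

Lemma convex_fine_slope (R : realType) (Phi : R -> \bar R) (u v M : R) :
  nonneg0 Phi -> nondecreasing0 Phi -> convex0 Phi -> (forall t, (0 <= t)%R -> Phi t < +oo) ->
  (0 <= u)%R -> (u <= v)%R -> (v <= M)%R ->
  (fine (Phi v) - fine (Phi u) <= fine (Phi (M + 1)) * (v - u))%R.
Proof.
move=> nn nd cvx fin u0 uv vM.
have ff x : (0 <= x)%R -> Phi x = (fine (Phi x))%:E.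
  by move=> x0; rewrite fineK// ge0_fin_numE ?fin// nn.
have f0 x : (0 <= x)%R -> (0 <= fine (Phi x))%R by move=> x0; rewrite fine_ge0// nn.
have v0 : (0 <= v)%R by exact: le_trans uv.
have M0 : (0 <= M + 1)%R by rewrite addr_ge0// (le_trans v0).
have uM : (0 < M + 1 - u)%R by move: uv vM; lra.
have [->|/eqP vu] := eqVneq v u; first by rewrite !subrr mulr0.
(* [v] is a convex combination of [u] and [M + 1], with weight [l] at [u]. The extra 1 makes the
   denominator [M + 1 - u] at least 1, so the slope is at most [Phi (M + 1)]. *)
pose l := ((M + 1 - v) / (M + 1 - u))%R.
have l01 : (0 < l < 1)%R.
  rewrite /l ltr_pdivrMr// mul1r divr_gt0//=; last by move: vM; lra.
  by have : (u < v)%R; [rewrite lt_neqAle uv andbT eq_sym; exact/eqP|lra].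
have lv : (l * u + (1 - l) * (M + 1) = v)%R by rewrite /l; field; rewrite gt_eqF.
have := cvx u (M + 1)%R l u0 M0 l01; rewrite lv.
rewrite (ff _ v0) (ff _ u0) (ff _ M0) -!EFinM -EFinD lee_fin.
have -> : (1 - l = (v - u) / (M + 1 - u))%R by rewrite /l; field; rewrite gt_eqF.
have lle : (l * fine (Phi u) <= fine (Phi u))%R.
  by rewrite ler_piMl ?f0//; case/andP: l01 => _ /ltW.
have : ((v - u) / (M + 1 - u) * fine (Phi (M + 1)) <= fine (Phi (M + 1)) * (v - u))%R.
  rewrite mulrC ler_wpM2l ?f0// ler_pdivrMr// ler_peMr ?subr_ge0//.
  by move: uv vM; lra.
by move: lle; lra.
Qed.

Lemma convex_abs_cont (R : realType) (Phi : R -> \bar R) :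
  nonneg0 Phi -> nondecreasing0 Phi -> convex0 Phi -> (forall t, (0 <= t)%R -> Phi t < +oo) ->
  abs_cont0 Phi.
Proof.
move=> nn nd cvx fin; split => // M M0 e e0.
(* The added 1 keeps the Lipschitz constant positive, so that [e / L] is a valid modulus. *)
pose L := (fine (Phi (M + 1)) + 1)%R.
have L0 : (0 < L)%R.
  by rewrite ltr_wpDl// fine_ge0// nn// addr_ge0// ltW.
exists (e / L)%R; first by rewrite divr_gt0.
move=> n u v uv _; rewrite ltr_pdivlMr// => sd.
apply: le_lt_trans sd; rewrite mulr_suml; apply: ler_sum => k _.
have [u0 [uvk vM]] := uv k (ltn_ord k).
have v0 := le_trans u0 uvk.
rewrite ger0_norm; last first.
  rewrite subr_ge0; apply: fine_le; rewrite ?ge0_fin_numE ?nn ?fin//.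
  exact: nd.
apply: (le_trans (@convex_fine_slope _ Phi (u k) (v k) M nn nd cvx fin u0 uvk vM)).
by rewrite mulrC ler_wpM2l ?subr_ge0// lerDl.
Qed.

Theorem theorem2p15 (R : realType) (Phi : R -> \bar R) :
  nonneg0 Phi -> nondecreasing0 Phi ->
  (cond_a Phi -> cond_b Phi) /\
      (cond_b Phi <-> cond_c Phi) /\
      (cond_c Phi <-> cond_d Phi) /\
      (Phip0 Phi < +oo -> (cond_c Phi <-> cond_e Phi)) /\
      (Phip0 Phi < +oo -> (cond_c Phi <-> cond_f Phi)) /\
      (abs_cont0 Phi -> (cond_a Phi <-> cond_b Phi)) /\
      (convex0 Phi -> (cond_a Phi <-> cond_b Phi)).
Proof.
move=> nn nd; have ab := cond_a_b _ nn nd.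
split=> //; split; first exact: iff_trans (cond_bP _ nn nd) (iff_sym (cond_cP _ nn nd)).
split; first exact: iff_trans (cond_cP _ nn nd) (iff_sym (cond_dP _ nn nd)).
split; first by move=> Py; exact: iff_trans (cond_cP _ nn nd) (iff_sym (cond_eP _ nn nd Py)).
split; first by move=> Py; exact: iff_trans (cond_cP _ nn nd) (iff_sym (cond_fP _ nn nd Py)).
split=> [ac|cvx]; first by split=> //; exact: cond_b_a.
(* A convex [Phi] may become infinite; then (a) holds by convention. Otherwise it is finite, hence
   absolutely continuous on bounded intervals. *)
split=> // b; have [EI|fin] := eventually_inftyP _ nd.
  by case: b => D [tD _]; exists D; split => //; left.
by apply: cond_b_a => //; exact: convex_abs_cont.
Qed.
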